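(* Let $p$ be a large prime, let $N_1,N_2$ be positive integers less than $p$, and let $I_1=[1,N_1]$, $I_2=[1,N_2]$. Let $\alpha_1(x_1)$ $(x_1\in I_1)$ and $\alpha_2(x_2)$ $(x_2\in I_2)$ be arbitrary complex numbers with $|\alpha_i(x_i)|\le 1$. Then, uniformly over all positive integers $k_1,k_2$ and all integers $a$ with $\gcd(a,p)=1$, $$\left|\sum_{x_1\in I_1}\sum_{x_2\in I_2}\alpha_1(x_1)\alpha_2(x_2)e_p(ax_1^*x_2^* )\right|<(2k_1)^{\frac{45k_1^2}{k_2}}(2k_2)^{\frac{45k_2^2}{k_1}}(\log p)^{2\left(\frac{k_1}{k_2}+\frac{k_2}{k_1}\right)}\left(\frac{N_1^{k_1-1}}{p^{1/2}}+\frac{p^{1/2}}{N_1^{k_1}}\right)^{\frac1{2k_1k_2}}\left(\frac{N_2^{k_2-1}}{p^{1/2}}+\frac{p^{1/2}}{N_2^{k_2}}\right)^{\frac1{2k_1k_2}}N_1N_2.$$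
   Context: $[1,N]$ denotes the set of integers $1,\dots,N$; $x^*$ is the multiplicative inverse of $x$ modulo $p$; $e_p(z)=e^{2\pi i z/p}$. ''Large prime'' means $p\ge p_0$ for some absolute constant $p_0$ (independent of $k_1,k_2,N_1,N_2$). *)

(* Defs.v *)
(* The complex numbers are R[i] from mathcomp-real-closed, over a realType R. *)
From mathcomp Require Import all_boot all_order all_algebra.
From mathcomp Require Import all_classical all_reals all_analysis.
From mathcomp Require Import complex.

Set Implicit Arguments.
Unset Strict Implicit.
Unset Printing Implicit Defensive.

Import Order.TTheory GRing.Theory Num.Theory.
Local Open Scope ring_scope.

(* Only meaningful for p prime: 'F_p is the field with p elements only then.
   The value is the representative in [0, p-1] (and 0 when p divides x). *)
Definition modinv (p x : nat) : nat := (x%:R : 'F_p)^-1.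

(* e^(2 pi i z / p), written through Euler's formula. *)
Definition ep (R : realType) (p : nat) (z : int) : R[i] :=
  let t : R := 2 * pi * z%:~R / p%:R in Complex (cos t) (sin t).

(* Main.v *)
(* Two applications of Hoelder's inequality and the L^2 bound for the additive
   Fourier transform on F_p reduce the sum to the 2k-th moments J_2k(N) =
   #{x_1^* + ... + x_k^* = y_1^* + ... + y_k^* mod p}, for k = k_1, k_2.
   Each x in [1,N]^k gives the rational number 1/x_1 + ... + 1/x_k = A/B with
   A <= k N^(k-1) and B <= N^k. Two distinct fractions A/B = A'/B' mod p satisfy
   p <= |A B' - A' B|, so a residue class contains O(k N^(2k-1) / p + 1) of them,
   and J_2k(N) is bounded by this number times the number of rational solutions
   of 1/x_1 + ... + 1/x_k = 1/y_1 + ... + 1/y_k.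
   In a rational solution, for each prime q, the largest q-adic valuation among
   the 2k variables occurs at least twice. Weighting each variable z <= N by
   (N / z)^(1/2) (Rankin's trick) bounds the number of solutions by N^k times an
   Euler product over q <= N whose factors are 1 + k(2k-1)/q + O_k(q^(-3/2)), and
   Chebyshev's bound for the primes in (2^j, 2^(j+1)] bounds this product by
   C_k (log p)^(2k(2k-1)). *)
Require Import Defs.
From mathcomp Require Import all_boot all_order all_algebra.
From mathcomp Require Import all_classical all_reals all_analysis.
From mathcomp Require Import complex.
From mathcomp Require Import ring lra zify.

Set Implicit Arguments.
Unset Strict Implicit.
Unset Printing Implicit Defensive.

Import Order.TTheory GRing.Theory Num.Theory.
Local Open Scope ring_scope.

(** * Hoelder's inequality and bilinear sums with an additive character *)

(** Tangent line at [t] to the convex function [x ^+ m.+1]. From one exponent to the next the gap is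
    multiplied by [x] and grows by [m.+1%:R * t ^+ m * (x - t) ^+ 2]. *)
Lemma bernoulli_homogeneous (C : numDomainType) (x t : C) (m : nat) :
  0 <= x -> 0 <= t -> t ^+ m.+1 + m.+1%:R * t ^+ m * (x - t) <= x ^+ m.+1.
Proof.
move=> x0 t0; elim: m => [|m IH].
  by rewrite expr0 !expr1 !mul1r addrC subrK.
have h : 0 <= m.+1%:R * t ^+ m * (x - t) ^+ 2.
  apply: mulr_ge0; first by rewrite mulr_ge0 ?exprn_ge0.
  by apply: real_exprn_even_ge0 => //; rewrite rpredB ?ger0_real.
rewrite [X in _ <= X]exprS -subr_ge0.
suff -> : x * x ^+ m.+1 - (t ^+ m.+2 + m.+2%:R * t ^+ m.+1 * (x - t)) =
  x * (x ^+ m.+1 - (t ^+ m.+1 + m.+1%:R * t ^+ m * (x - t)))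
  + m.+1%:R * t ^+ m * (x - t) ^+ 2.
  by rewrite addr_ge0 // mulr_ge0 // subr_ge0.
by rewrite !exprS expr0 -!natr1; ring.
Qed.

(** The tangent-line inequality at [T] is applied to the points [S * a i], weighted by [w i] and
    summed; the linear terms cancel because [\sum_i w i * (S * a i - T) = 0]. *)
Lemma weighted_power_mean (C : numDomainType) (I : finType) (w a : I -> C) m :
  (forall i, 0 <= w i) -> (forall i, 0 <= a i) ->
  (\sum_i w i * a i) ^+ m.+1 <= (\sum_i w i) ^+ m * \sum_i w i * a i ^+ m.+1.
Proof.
move=> w0 a0; set S := \sum_i w i; set T := \sum_i w i * a i.
have S0 : 0 <= S by apply: sumr_ge0.
have T0 : 0 <= T by apply: sumr_ge0 => i _; rewrite mulr_ge0.
have [S_eq0|S_neq0] := eqVneq S 0.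
  have w_eq0 i : w i = 0.
    have /eqP := S_eq0; rewrite /S psumr_eq0 => [/allP /(_ i)|//].
    by rewrite mem_index_enum => /(_ isT)/eqP.
  rewrite /T big1 => [|i _]; last by rewrite w_eq0 mul0r.
  by rewrite expr0n /= mulr_ge0 ?exprn_ge0 // sumr_ge0 // => i _; rewrite mulr_ge0 ?exprn_ge0.
have Sgt0 : 0 < S by rewrite lt_def S_neq0.
rewrite -(ler_pM2l Sgt0) mulrA -exprS mulr_sumr.
have -> : S * T ^+ m.+1 =
    \sum_i w i * (T ^+ m.+1 + m.+1%:R * T ^+ m * (S * a i - T)).
  transitivity (S * T ^+ m.+1 + m.+1%:R * T ^+ m * (S * T - S * T)).
    by rewrite subrr mulr0 addr0.
  under eq_bigr do rewrite mulrDr.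
  rewrite big_split /= -mulr_suml; congr (_ + _).
  transitivity (m.+1%:R * T ^+ m * \sum_i (w i * (S * a i - T))).
    congr (_ * _); under eq_bigr do rewrite mulrBr mulrCA.
    by rewrite sumrB -mulr_sumr -mulr_suml.
  by rewrite mulr_sumr; apply: eq_bigr => i _; rewrite mulrCA.
apply: ler_sum => i _; rewrite mulrCA -exprMn.
by apply: ler_wpM2l => //; apply: bernoulli_homogeneous => //; rewrite mulr_ge0.
Qed.

Lemma power_mean (C : numDomainType) (I : finType) (a : I -> C) m :
  (forall i, 0 <= a i) ->
  (\sum_i a i) ^+ m.+1 <= #|I|%:R ^+ m * \sum_i a i ^+ m.+1.
Proof.
move=> a0; have := @weighted_power_mean _ I (fun=> 1) a m (fun=> ler01) a0.
rewrite sumr_const cardT -cardE.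
by under eq_bigr do rewrite mul1r; under [X in _ * X]eq_bigr do rewrite mul1r.
Qed.

(** Lagrange's identity for the moduli: twice the gap is a double sum of squares. *)
Lemma cauchy_schwarz (C : numClosedFieldType) (I : finType) (a b : I -> C) :
  `|\sum_i a i * b i| ^+ 2 <= (\sum_i `|a i| ^+ 2) * \sum_i `|b i| ^+ 2.
Proof.
apply: (@le_trans _ _ ((\sum_i `|a i| * `|b i|) ^+ 2)).
  rewrite ler_pXn2r ?nnegrE ?sumr_ge0 //; try by move=> i _; rewrite mulr_ge0.
  by apply: le_trans (ler_norm_sum _ _ _) _; apply: ler_sum => i _; rewrite normrM.
rewrite -subr_ge0.
have h : 0 <= \sum_i \sum_j (`|a i| * `|b j| - `|a j| * `|b i|) ^+ 2.
  apply: sumr_ge0 => i _; apply: sumr_ge0 => j _.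
  by apply: real_exprn_even_ge0 => //; rewrite rpredB ?rpredM // normr_real.
suff : (\sum_i \sum_j (`|a i| * `|b j| - `|a j| * `|b i|) ^+ 2) =
  2%:R * ((\sum_i `|a i| ^+ 2) * (\sum_i `|b i| ^+ 2) - (\sum_i `|a i| * `|b i|) ^+ 2).
  by move=> e; move: h; rewrite e pmulr_rge0 // ltr0n.
pose u i := `|a i| ^+ 2; pose v i := `|b i| ^+ 2; pose w i := `|a i| * `|b i|.
transitivity (\sum_i \sum_j (u i * v j + u j * v i - 2%:R * (w i * w j))).
  by apply: eq_bigr => i _; apply: eq_bigr => j _; rewrite /u /v /w; ring.
under eq_bigr do rewrite sumrB big_split /= -mulr_sumr -mulr_suml -!mulr_sumr.
rewrite sumrB big_split /= -mulr_suml -!mulr_sumr -mulr_suml /u /v /w; ring.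
Qed.

(** Trades a modulus for a bounded coefficient, so that powers of moduli can be expanded like powers
    of sums. The witness is informative, hence can be chosen as a function of an index. *)
Lemma norm_unit_factor (C : numClosedFieldType) (z : C) :
  {t : C | `|t| <= 1 & `|z| = t * z}.
Proof.
have [->|z0] := eqVneq z 0; first by exists 0; rewrite ?normr0 ?mulr0.
exists (`|z| / z); last by rewrite divfK.
by rewrite normrM normfV normr_id divff ?normr_eq0.
Qed.

Section Bilinear.
Variables (C : numClosedFieldType) (F : finFieldType) (psi : F -> C).
Hypothesis psiD : {morph psi : x y / x + y >-> x * y}.
Hypothesis norm_psi : forall x, `|psi x| = 1.
Hypothesis psi_sum : forall c, c != 0 -> \sum_x psi (c * x) = 0.

Definition representations (X : finType) (h : X -> F) k (c : F) :=
  [set f : {ffun 'I_k -> X} | \sum_i h (f i) == c].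

(** Sorted by the common value [c] of both sides, this is the number J_2k of solutions of h(x_1) +
    ... + h(x_k) = h(y_1) + ... + h(y_k). *)
Definition energy (X : finType) (h : X -> F) k :=
  (\sum_c #|representations h k c| ^ 2)%N.

Definition power_coef (X : finType) (h : X -> F) (b : X -> C) k (c : F) :=
  \sum_(f in representations h k c) \prod_i b (f i).

Lemma psi0 : psi 0 = 1.
Proof.
have p0 : psi 0 != 0 by rewrite -normr_eq0 norm_psi oner_eq0.
by apply: (mulfI p0); rewrite -psiD addr0 mulr1.
Qed.

Lemma norm_power_coef (X : finType) (h : X -> F) (b : X -> C) k c :
  (forall x, `|b x| <= 1) ->
  `|power_coef h b k c| <= #|representations h k c|%:R.
Proof.
move=> b1; apply: le_trans (ler_norm_sum _ _ _) _.
rewrite -sum1_card natr_sum; apply: ler_sum => f _.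
by rewrite normr_prod; apply: prodr_ile1 => i _; rewrite normr_ge0 b1.
Qed.

Lemma power_expand (X : finType) (h : X -> F) (b : X -> C) k t :
  (\sum_x b x * psi (h x * t)) ^+ k = \sum_c power_coef h b k c * psi (c * t).
Proof.
rewrite -[in LHS](card_ord k) -prodr_const bigA_distr_bigA /=.
rewrite (partition_big (fun f : {ffun 'I_k -> X} => \sum_i h (f i)) xpredT) //=.
apply: eq_bigr => c _; rewrite mulr_suml; apply: eq_big => [f|f /eqP <-].
  by rewrite inE.
rewrite big_split /= mulr_suml; congr (_ * _).
by rewrite (big_morph _ psiD psi0).
Qed.

Lemma sum_representations (X : finType) (h : X -> F) k :
  (\sum_c #|representations h k c|)%N = (#|X| ^ k)%N.
Proof.
under eq_bigr do rewrite -sum1_card.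
transitivity (#|{ffun 'I_k -> X}|); last by rewrite card_ffun card_ord.
rewrite -sum1_card (partition_big (fun f : {ffun 'I_k -> X} => \sum_i h (f i)) xpredT) //=.
by apply: eq_bigr => c _; apply: eq_bigl => f; rewrite inE.
Qed.

(** Once the square is expanded, the sum over [c] of [psi ((d - e) * c)] vanishes unless [d = e]. *)
Lemma parseval (v : F -> C) :
  \sum_c `|\sum_d v d * psi (d * c)| ^+ 2 = #|F|%:R * \sum_d `|v d| ^+ 2.
Proof.
have psiN x : (psi x)^* = psi (- x).
  apply: (@mulfI _ (psi x)); first by rewrite -normr_eq0 norm_psi oner_eq0.
  by rewrite -psiD subrr psi0 -normCK norm_psi expr1n.
transitivity (\sum_c \sum_d \sum_e v d * (v e)^* * psi ((d - e) * c)).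
  apply: eq_bigr => c _; rewrite normCK rmorph_sum mulr_suml.
  apply: eq_bigr => d _; rewrite mulr_sumr; apply: eq_bigr => e _.
  by rewrite rmorphM /= psiN mulrBl psiD; ring.
rewrite exchange_big mulr_sumr; apply: eq_bigr => d _.
rewrite exchange_big (bigD1 d) //= [X in _ + X]big1 => [|e ed]; last first.
  by rewrite -mulr_sumr psi_sum ?mulr0 // subr_eq0 eq_sym.
rewrite addr0 normCK; under eq_bigr do rewrite subrr mul0r psi0 mulr1.
by rewrite sumr_const mulr_natl.
Qed.

Lemma bilinear_form_bound (u v : F -> C) :
  `|\sum_c u c * \sum_d v d * psi (d * c)| ^+ 2 <=
  (\sum_c `|u c| ^+ 2) * (#|F|%:R * \sum_d `|v d| ^+ 2).
Proof. by apply: le_trans (cauchy_schwarz _ _) _; rewrite parseval. Qed.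

Lemma energyE (X : finType) (h : X -> F) k :
  (energy h k)%:R = \sum_c #|representations h k c|%:R ^+ 2 :> C.
Proof. by rewrite natr_sum; apply: eq_bigr => c _; rewrite natrX. Qed.

(** Hoelder in [x2] with exponent [m1.+1] replaces the [x1]-sum by a sum over [c] weighted by
    representation counts [r1]; Hoelder in [c] with exponent [m2.+1] does the same for [x2]. What
    remains is a bilinear form on F whose coefficients have squared L^2 norms bounded by the two
    energies. *)
Theorem bilinear_sum_bound (X1 X2 : finType) (h1 : X1 -> F) (h2 : X2 -> F)
    (b1 : X1 -> C) (b2 : X2 -> C) (m1 m2 : nat) :
  (forall x, `|b1 x| <= 1) -> (forall x, `|b2 x| <= 1) ->
  `|\sum_x1 \sum_x2 b1 x1 * b2 x2 * psi (h1 x1 * h2 x2)|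
     ^+ (2 * (m1.+1 * m2.+1)) <=
  (#|X2| ^ (m1 * m2.+1) * #|X1| ^ (m1.+1 * m2))%:R ^+ 2 *
  (#|F| * energy h1 m1.+1 * energy h2 m2.+1)%:R.
Proof.
move=> hb1 hb2; set W := \sum_x1 _.
pose T x2 := \sum_x1 b1 x1 * psi (h1 x1 * h2 x2).
pose r1 c := #|representations h1 m1.+1 c|%:R : C.
have W1 : `|W| ^+ m1.+1 <= #|X2|%:R ^+ m1 * \sum_x2 `|T x2| ^+ m1.+1.
  apply: le_trans (power_mean m1 (fun x2 => normr_ge0 (T x2))).
  rewrite ler_pXn2r ?nnegrE ?sumr_ge0 //.
  rewrite /W exchange_big; apply: le_trans (ler_norm_sum _ _ _) _.
  apply: ler_sum => x2 _.
  have -> : \sum_x1 b1 x1 * b2 x2 * psi (h1 x1 * h2 x2) = b2 x2 * T x2.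
    by rewrite mulr_sumr; apply: eq_bigr => x1 _; rewrite mulrCA mulrA.
  by rewrite normrM ler_piMl.
pose th x2 := s2val (norm_unit_factor (T x2 ^+ m1.+1)).
have th1 x2 : `|th x2| <= 1 by exact: s2valP (norm_unit_factor _).
have thE x2 : `|T x2| ^+ m1.+1 = th x2 * T x2 ^+ m1.+1.
  by rewrite -normrX; exact: s2valP' (norm_unit_factor _).
pose U c := \sum_x2 th x2 * psi (h2 x2 * c).
have W2 : \sum_x2 `|T x2| ^+ m1.+1 <= \sum_c r1 c * `|U c|.
  have sumE : \sum_x2 `|T x2| ^+ m1.+1 = \sum_c power_coef h1 b1 m1.+1 c * U c.
    under eq_bigr => x2 _ do rewrite thE /T power_expand mulr_sumr.
    rewrite exchange_big; apply: eq_bigr => c _; rewrite mulr_sumr.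
    by apply: eq_bigr => x2 _; rewrite mulrCA [h2 x2 * c]mulrC.
  rewrite -[leLHS]ger0_norm; last by apply: sumr_ge0 => x2 _; rewrite exprn_ge0.
  rewrite sumE; apply: le_trans (ler_norm_sum _ _ _) _; apply: ler_sum => c _.
  by rewrite normrM ler_wpM2r // norm_power_coef.
(* The weights [r1] have total mass [#|X1| ^ m1.+1], whose [m2]-th power is the factor in front. *)
have W3 : (\sum_c r1 c * `|U c|) ^+ m2.+1 <=
    #|X1|%:R ^+ (m1.+1 * m2) * \sum_c r1 c * `|U c| ^+ m2.+1.
  have := @weighted_power_mean _ _ r1 (fun c => `|U c|) m2 (fun=> ler0n _ _) (fun=> normr_ge0 _).
  by rewrite {2}/r1 -natr_sum sum_representations natrX -exprM.
pose et c := s2val (norm_unit_factor (U c ^+ m2.+1)).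
have et1 c : `|et c| <= 1 by exact: s2valP (norm_unit_factor _).
have etE c : `|U c| ^+ m2.+1 = et c * U c ^+ m2.+1.
  by rewrite -normrX; exact: s2valP' (norm_unit_factor _).
have W4 : (\sum_c r1 c * `|U c| ^+ m2.+1) ^+ 2 <=
    #|F|%:R * (energy h1 m1.+1)%:R * (energy h2 m2.+1)%:R.
  have sumE : \sum_c r1 c * `|U c| ^+ m2.+1 =
      \sum_c (r1 c * et c) * \sum_d power_coef h2 th m2.+1 d * psi (d * c).
    by apply: eq_bigr => c _; rewrite etE /U power_expand mulrA.
  rewrite -[X in X ^+ 2]ger0_norm; last first.
    by apply: sumr_ge0 => c _; rewrite mulr_ge0 ?exprn_ge0.
  rewrite sumE; apply: le_trans (bilinear_form_bound _ _) _.
  rewrite mulrCA -mulrA ler_wpM2l // !energyE.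
  apply: ler_pM; rewrite ?sumr_ge0 //; try by move=> c _; rewrite exprn_ge0.
    apply: ler_sum => c _; rewrite ler_pXn2r ?nnegrE // normrM.
    by rewrite [X in X * _]ger0_norm // ler_piMr.
  apply: ler_sum => c _; rewrite ler_pXn2r ?nnegrE //.
  exact: norm_power_coef.
have W5 : `|W| ^+ (m1.+1 * m2.+1) <=
   (#|X2| ^ (m1 * m2.+1) * #|X1| ^ (m1.+1 * m2))%:R * \sum_c r1 c * `|U c| ^+ m2.+1.
  rewrite exprM; apply: (@le_trans _ _ ((#|X2|%:R ^+ m1 * \sum_c r1 c * `|U c|) ^+ m2.+1)).
    rewrite ler_pXn2r ?nnegrE ?exprn_ge0 //.
      by apply: le_trans W1 _; rewrite ler_wpM2l ?exprn_ge0.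
    by rewrite mulr_ge0 ?exprn_ge0 // sumr_ge0 // => c _; rewrite mulr_ge0.
  rewrite exprMn -exprM natrM !natrX -mulrA.
  by rewrite ler_wpM2l ?exprn_ge0.
rewrite mulnC exprM.
apply: (@le_trans _ _ (((#|X2| ^ (m1 * m2.+1) * #|X1| ^ (m1.+1 * m2))%:R *
    \sum_c r1 c * `|U c| ^+ m2.+1) ^+ 2)).
  rewrite ler_pXn2r ?nnegrE ?exprn_ge0 // mulr_ge0 // sumr_ge0 // => c _.
  by rewrite mulr_ge0 ?exprn_ge0.
rewrite exprMn; apply: ler_wpM2l; first by rewrite exprn_ge0.
by rewrite !natrM.
Qed.

End Bilinear.

(** * Congruences between sums of inverses *)

(** Cauchy-Schwarz over the distinct values of [h] on [S]. It will be used with [S] a residue class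
    of solutions and [h] their rational value. *)
Lemma card_sqr_le_collisions (X : finType) (T : eqType) (h : X -> T) (S : {set X}) :
  (#|S| ^ 2 <= size (undup [seq h x | x in S]) *
               \sum_(x in S) \sum_(y in S) (h x == h y))%N.
Proof.
set V := undup _; pose g r := (\sum_(x in S) (h x == r))%N.
have Vsum (c : T -> nat) x : x \in S -> (\sum_(r <- V) (h x == r) * c r = c (h x))%N.
  move=> xS; have hxV : h x \in V by rewrite mem_undup; apply/fintype.imageP; exists x.
  rewrite (bigD1_seq (h x)) ?undup_uniq //= eqxx mul1n big1 ?addn0 // => r.
  by rewrite eq_sym => /negbTE ->.
have -> : #|S| = (\sum_(r <- V) g r)%N.
  rewrite exchange_big /= -sum1_card; apply: eq_bigr => x xS.
  by rewrite -[LHS](Vsum (fun=> 1%N) x xS); apply: eq_bigr => r _; rewrite muln1.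
have -> : (\sum_(x in S) \sum_(y in S) (h x == h y) = \sum_(r <- V) g r ^ 2)%N.
  have -> : (\sum_(r <- V) g r ^ 2 = \sum_(r <- V) \sum_(x in S) (h x == r) * g r)%N.
    by apply: eq_bigr => r _; rewrite -big_distrl.
  rewrite [RHS]exchange_big; apply: eq_bigr => x xS /=.
  by rewrite Vsum //; apply: eq_bigr => y _; rewrite eq_sym.
rewrite !(big_tnth _ _ V) -(ler_nat rat) natrX natr_sum natrM natr_sum.
have := @power_mean rat _ (fun i => (g (tnth (in_tuple V) i))%:R) 1 (fun=> ler0n _ _).
by rewrite card_ord; under [X in _ * X]eq_bigr do rewrite -natrX.
Qed.

(** The map sending [x] to the integer part of [x / d] is injective on a [d]-separated set. *)
Lemma size_separated_seq (s : seq rat) (d th : rat) :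
  0 < d -> uniq s -> (forall x, x \in s -> 0 <= x <= th) ->
  {in s &, forall x y, x != y -> d <= `|x - y|} ->
  0 <= th -> (size s)%:R <= th / d + 1.
Proof.
move=> d0 us sth ssep th0; pose t (x : rat) := Num.truncn (x / d).
have tP x : 0 <= x -> ((t x)%:R <= x / d < (t x).+1%:R)%R.
  by move=> x0; apply: Num.Theory.truncn_itv; rewrite divr_ge0 // ltW.
have ut : uniq (map t s).
  rewrite map_inj_in_uniq // => x y xs ys txy; apply/eqP/negPn/negP => xy.
  have := ssep _ _ xs ys xy; apply/negP; rewrite -ltNge.
  have /andP[x0 _] := sth _ xs; have /andP[y0 _] := sth _ ys.
  have /andP[] := tP _ x0; have /andP[] := tP _ y0.
  rewrite txy -natr1 !ler_pdivlMr // !ltr_pdivrMr // mulrDl mul1r.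
  set z := _ * d => a1 a2 a3 a4.
  by rewrite ltr_norml; apply/andP; split; lra.
have /(uniq_leq_size ut) : {subset map t s <= iota 0 (t th).+1}.
  move=> _ /mapP[x xs ->]; rewrite mem_iota add0n /= ltnS.
  have /andP[x0 xth] := sth _ xs.
  by rewrite /t Num.Theory.le_truncn // ler_pM2r // invr_gt0.
rewrite size_map size_iota -(ler_nat rat) => /le_trans; apply.
by rewrite -natr1 lerD2r; have /andP[] := tP _ th0.
Qed.

(** Both products are congruent to [mu * b * b'], so [p] divides their nonzero difference. *)
Lemma congruent_products_gap (p : nat) (mu : 'F_p) (a b a' b' : nat) :
  prime p -> a%:R = mu * b%:R -> a'%:R = mu * b'%:R ->
  (a * b' != a' * b)%N -> p%:R <= `|(a * b')%:R - (a' * b)%:R| :> rat.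
Proof.
move=> pp ha ha'; wlog lt : a b a' b' ha ha' / (a' * b < a * b')%N.
  move=> W ne; have := ne; rewrite neq_ltn => /orP[lt|lt]; last exact: W.
  by rewrite distrC; apply: W => //; rewrite eq_sym.
move=> _; rewrite -natrB ?(ltnW lt) // normr_nat ler_nat.
apply: dvdn_leq; first by rewrite subn_gt0.
rewrite (dvdn_pcharf (pchar_Fp pp)) natrB ?(ltnW lt) // !natrM ha ha' subr_eq0.
by rewrite -!mulrA [b%:R * _]mulrC.
Qed.

Lemma count_congruent_fractions (p A B : nat) (mu : 'F_p) (s : seq rat) :
  prime p -> uniq s ->
  (forall r, r \in s -> exists a b : nat,
     [/\ (0 < a <= A)%N, (0 < b <= B)%N, r = a%:R / b%:R & a%:R = mu * b%:R]) ->
  (p * size s <= 2 * A * B + 2 * p)%N.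
Proof.
move=> pp us hs; have [->|[r0 r0s]] : s = [::] \/ exists r, r \in s.
- by case: (s) => [|r s']; [left | right; exists r; rewrite mem_head].
- by rewrite muln0.
have [a0 [b0 [/andP[a0_gt0 a0A] /andP[b0_gt0 b0B] _ _]]] := hs _ r0s.
have A0 : 0 < A%:R :> rat by rewrite ltr0n (leq_trans a0_gt0).
have B0 : 0 < B%:R :> rat by rewrite ltr0n (leq_trans b0_gt0).
have p0 : 0 < p%:R :> rat by rewrite ltr0n prime_gt0.
(* The fractions r <= A/B are p/B^2-separated, and the inverses of the others are
   p/A^2-separated in [0, B/A]; both counts are at most A B / p + 1. *)
pose P (r : rat) := r <= A%:R / B%:R.
have le1 : (size (seq.filter P s))%:R <= (A%:R / B%:R) / (p%:R / B%:R ^+ 2) + 1 :> rat.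
  apply: size_separated_seq; rewrite ?divr_gt0 ?divr_ge0 ?exprn_gt0 ?filter_uniq //.
  - move=> r; rewrite mem_filter => /andP[rP /hs [a [b [_ _ re _]]]].
    by apply/andP; split=> //; rewrite re divr_ge0.
  - move=> r r'; rewrite !mem_filter => /andP[_ /hs [a [b [ha hb -> hab]]]].
    move=> /andP[_ /hs [a' [b' [ha' hb' -> hab']]]].
    case/andP: hb => b_gt0 bB; case/andP: hb' => b'_gt0 b'B.
    rewrite eqr_div ?pnatr_eq0 -?lt0n // -!natrM eqr_nat => ne.
    have := congruent_products_gap pp hab hab' ne.
    have -> : a%:R / b%:R - a'%:R / b'%:R =
        ((a * b')%:R - (a' * b)%:R) / (b * b')%:R :> rat.
      by rewrite !natrM; field; rewrite ?pnatr_eq0 -?lt0n b_gt0 b'_gt0.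
    rewrite normrM normfV normr_nat => gap.
    apply: ler_pM; rewrite ?invr_ge0 ?exprn_ge0 //.
    by rewrite lef_pV2 ?posrE ?exprn_gt0 // ?ltr0n ?muln_gt0 ?b_gt0 // -natrX ler_nat leq_mul.
have le2 : (size (map (fun r => r^-1) (seq.filter (predC P) s)))%:R <=
    (B%:R / A%:R) / (p%:R / A%:R ^+ 2) + 1 :> rat.
  apply: size_separated_seq; rewrite ?divr_gt0 ?divr_ge0 ?exprn_gt0 //.
  - by rewrite map_inj_uniq ?filter_uniq //; apply: invr_inj.
  - move=> _ /mapP[r + ->]; rewrite mem_filter => /andP[/= nP /hs [a [b [_ _ re _]]]].
    apply/andP; split; first by rewrite re invr_ge0 divr_ge0.
    move: nP; rewrite /P -ltNge => /ltW nP.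
    by rewrite -[leRHS]invrK invf_div lef_pV2 // ?posrE ?divr_gt0 // (lt_le_trans _ nP) ?divr_gt0.
  - move=> _ _ /mapP[r rs ->] /mapP[r' rs' ->].
    move: rs rs'; rewrite !mem_filter => /andP[_ /hs [a [b [ha hb -> hab]]]].
    move=> /andP[_ /hs [a' [b' [ha' hb' -> hab']]]].
    case/andP: ha => a_gt0 aA; case/andP: ha' => a'_gt0 a'A.
    rewrite !invf_div eqr_div ?pnatr_eq0 -?lt0n // -!natrM eqr_nat => ne.
    have ne' : (a * b' != a' * b)%N by rewrite eq_sym [(a * _)%N]mulnC [(a' * _)%N]mulnC.
    have := congruent_products_gap pp hab hab' ne'.
    have -> : b%:R / a%:R - b'%:R / a'%:R =
        ((a' * b)%:R - (a * b')%:R) / (a * a')%:R :> rat.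
      by rewrite !natrM; field; rewrite ?pnatr_eq0 -?lt0n a_gt0 a'_gt0.
    rewrite distrC normrM normfV normr_nat => gap.
    apply: ler_pM; rewrite ?invr_ge0 ?exprn_ge0 //.
    by rewrite lef_pV2 ?posrE ?exprn_gt0 // ?ltr0n ?muln_gt0 ?a_gt0 // -natrX ler_nat leq_mul.
have e1 : (A%:R / B%:R) / (p%:R / B%:R ^+ 2) = A%:R * B%:R / p%:R :> rat.
  by field; rewrite !gt_eqF.
have e2 : (B%:R / A%:R) / (p%:R / A%:R ^+ 2) = A%:R * B%:R / p%:R :> rat.
  by field; rewrite !gt_eqF.
rewrite -(ler_nat rat) !(natrD, natrM) -(count_predC P s) natrD.
move: le1 le2; rewrite size_map !size_filter e1 e2.
set u := A%:R * B%:R / p%:R => le1 le2.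
have -> : 2 * A%:R * B%:R + 2 * p%:R = p%:R * (2 * u + 2) :> rat.
  by rewrite /u; field; rewrite gt_eqF.
by rewrite ler_pM2l //; lra.
Qed.

Lemma sum_inverses_common_denominator (F : fieldType) (k : nat) (x : 'I_k -> nat) :
  (forall i, (x i)%:R != 0 :> F) ->
  (\sum_i \prod_(j | j != i) x j)%:R = (\sum_i (x i)%:R^-1) * (\prod_i x i)%:R :> F.
Proof.
move=> x0; rewrite natr_sum mulr_suml; apply: eq_bigr => i _.
by rewrite [in RHS](bigD1 i) //= natrM mulrA mulVf ?mul1r.
Qed.

Definition inverse_sum (k N : nat) (x : {ffun 'I_k -> 'I_N}) : rat :=
  \sum_i (x i).+1%:R^-1.

Definition rational_energy (k N : nat) : nat :=
  (\sum_(x : {ffun 'I_k -> 'I_N}) \sum_(y : {ffun 'I_k -> 'I_N})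
    (inverse_sum x == inverse_sum y))%N.

(** Each residue class [c] contains few rational values, so its squared size is controlled by the
    rational coincidences inside it; summed over [c], these are at most all the rational
    coincidences. *)
Lemma energy_inverses_le (p k N : nat) :
  prime p -> (N < p)%N ->
  (p * energy (fun i : 'I_N => i.+1%:R^-1 : 'F_p) k.+1 <=
   (2 * (k.+1 * N ^ k) * N ^ k.+1 + 2 * p) * rational_energy k.+1 N)%N.
Proof.
move=> pp Np; set h := fun i : 'I_N => _.
pose rho := @inverse_sum k.+1 N.
pose S := representations h k.+1.
have key c : (p * #|S c| ^ 2 <= (2 * (k.+1 * N ^ k) * N ^ k.+1 + 2 * p) *
    \sum_(x in S c) \sum_(y in S c) (rho x == rho y))%N.
  apply: (leq_trans (leq_mul (leqnn p) (card_sqr_le_collisions rho (S c)))).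
  rewrite mulnA; apply: leq_mul => //.
  apply: (@count_congruent_fractions p _ _ c); rewrite ?undup_uniq // => r.
  rewrite mem_undup => /fintype.imageP[x]; rewrite inE => /eqP xc ->.
  (* The fraction is written over the product of all variables, unreduced. This product is prime to
     [p] since every variable is at most [N < p]. *)
  exists (\sum_i \prod_(j | j != i) (x j).+1)%N, (\prod_i (x i).+1)%N.
  have xpos i : ((x i).+1)%:R != 0 :> 'F_p.
    rewrite -(dvdn_pcharf (pchar_Fp pp)); apply/negP => /dvdn_leq.
    by move=> /(_ isT); rewrite leqNgt (leq_ltn_trans (ltn_ord (x i)) Np).
  have xpos' i : ((x i).+1)%:R != 0 :> rat by rewrite pnatr_eq0.
  split.
  - rewrite big_ord_recl addn_gt0 prodn_gt0 //=.
    rewrite -(big_ord_recl k (fun i => \prod_(j | j != i) (x j).+1)%N).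
    apply: (@leq_trans (\sum_(i < k.+1) N ^ k)); last by rewrite sum_nat_const card_ord.
    apply: leq_sum => i _; apply: (@leq_trans (\prod_(j | j != i) N)).
      by apply: leq_prod => j _; apply: ltn_ord.
    by rewrite prod_nat_const cardC1 card_ord.
  - rewrite prodn_gt0 //=; apply: (@leq_trans (\prod_(j < k.+1) N)).
      by apply: leq_prod => j _; apply: ltn_ord.
    by rewrite prod_nat_const card_ord.
  - rewrite (sum_inverses_common_denominator xpos') mulfK // pnatr_eq0 -lt0n.
    exact: prodn_gt0.
  - by rewrite (sum_inverses_common_denominator xpos); congr (_ * _).
rewrite /energy big_distrr /=.
apply: (leq_trans (leq_sum _ (fun c _ => key c))).
rewrite -big_distrr /= leq_mul // /rational_energy.
rewrite (partition_big (fun f : {ffun 'I_k.+1 -> 'I_N} => \sum_i h (f i)) xpredT) //=.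
apply: leq_sum => c _.
under eq_bigl do rewrite inE; apply: leq_sum => x _.
by rewrite [X in (_ <= X)%N](bigID (mem (S c))) /= leq_addr.
Qed.

(** * Rational solutions and the Euler product *)

(* Says, for n > 0, that the maximum of e is attained at least twice. *)
Definition max_twice (n : nat) (e : 'I_n -> nat) : bool :=
  [forall i, exists j, (j != i) && (e i <= e j)%N].

(** If [z i] alone had the largest [q]-adic valuation, then after clearing denominators the cofactor
    [P i] would alone have the smallest one, so a power of [q] dividing all the other terms would
    have to divide it too. *)
Lemma max_twice_logn (n : nat) (z : 'I_n -> nat) (sg : 'I_n -> bool) (q : nat) :
  prime q -> (forall i, 0 < z i)%N ->
  \sum_i (-1) ^+ sg i * (z i)%:R^-1 = 0 :> rat ->
  max_twice (fun i => logn q (z i)).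
Proof.
move=> pq z0 zsum; apply/forallP => i; apply: contraT => /existsPn smaller.
pose P j := (\prod_(l | l != j) z l)%N.
have P0 j : (0 < P j)%N by rewrite prodn_gt0.
have PE j : (P j * z j = P i * z i)%N.
  by rewrite ![(P _ * _)%N]mulnC /P -!(bigD1 _ (P := xpredT) (F := z)).
have sumP : \sum_j (-1) ^+ sg j * (P j)%:Z = 0 :> int.
  apply: (@intr_inj rat); rewrite rmorph_sum rmorph0.
  have := congr1 (fun t => t * (P i * z i)%:R) zsum; rewrite mul0r; apply: etrans.
  rewrite mulr_suml; apply: eq_bigr => j _.
  rewrite rmorphM rmorphXn rmorphN1 /= -mulrA; congr (_ * _).
  by rewrite -(PE j) natrM mulrCA mulVf ?mulr1 // pnatr_eq0 -lt0n.
pose T := (logn q (P i)).+1.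
have dvdP j : j != i -> (q ^ T %| P j)%N.
  move=> ji; rewrite pfactor_dvdn // /T.
  have /(congr1 (logn q)) := PE j; rewrite !lognM //.
  by move: (smaller j); rewrite ji /= -ltnNge; lia.
have : ((q ^ T)%:Z %| (-1) ^+ sg i * (P i)%:Z)%Z.
  move/eqP: sumP; rewrite (bigD1 i) //= addr_eq0 => /eqP ->.
  rewrite rpredN; apply: rpred_sum => j ji; apply: dvdz_mull.
  exact: dvdP.
rewrite dvdzE abszMsign absz_nat [`|_|%N]absz_nat pfactor_dvdn //.
by rewrite ltnn.
Qed.

(** A solution (x, y) is glued into one vector of length 2k, with sign + on the first half and - on
    the second. *)
Lemma rational_energy_le_max_twice (k N : nat) :
  (rational_energy k N <=
   #|[set z : {ffun 'I_(k + k) -> 'I_N} |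
       [forall q : 'I_N.+1, prime q ==> max_twice (fun i => logn q (z i).+1)]]|)%N.
Proof.
pose X : finType := {ffun 'I_k -> 'I_N}.
pose join (xy : X * X) : {ffun 'I_(k + k) -> 'I_N} :=
  [ffun i => match fintype.split i with inl j => xy.1 j | inr j => xy.2 j end].
have jl xy j : join xy (lshift k j) = xy.1 j.
  by rewrite ffunE (unsplitK (inl j)).
have jr xy j : join xy (rshift k j) = xy.2 j.
  by rewrite ffunE (unsplitK (inr j)).
have join_inj : injective join.
  move=> [x y] [x' y'] e; congr (_, _); apply/ffunP => j.
    by have := congr1 (fun z : {ffun _} => z (lshift k j)) e; rewrite !jl.
  by have := congr1 (fun z : {ffun _} => z (rshift k j)) e; rewrite !jr.
have -> : rational_energy k N =
    #|[set xy : X * X | inverse_sum xy.1 == inverse_sum xy.2]|.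
  rewrite /rational_energy pair_big /= -sum1_card big_mkcond [RHS]big_mkcond /=.
  by apply: eq_bigr => xy _; rewrite inE; case: (_ == _).
rewrite -(card_imset _ join_inj); apply/subset_leq_card/fintype.subsetP => _ /imsetP[xy + ->].
rewrite !inE => /eqP e; apply/forallP => q; apply/implyP => pq.
apply: (@max_twice_logn _ _ (fun i => if fintype.split i is inl _ then false else true)) => //.
rewrite big_split_ord /=.
under eq_bigr => j _ do rewrite jl (unsplitK (inl j)) mul1r.
under [X in _ + X]eq_bigr => j _ do rewrite jr (unsplitK (inr j)) expr1 mulN1r.
by rewrite sumrN; apply/eqP; rewrite subr_eq0; apply/eqP.
Qed.

(** Euler factor at a prime q, with [s] = q^(-1/2): [e] lists the q-adic valuations of the
    variables, truncated below [L]. *)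
Definition local_factor (R : numDomainType) (n L : nat) (s : R) : R :=
  \sum_(e : {ffun 'I_n -> 'I_L} | max_twice (fun i => e i)) \prod_i s ^+ e i.

(** The value at [m = 0] is 0, so sums over [q] may start at 0. *)
Definition inv_sqrt (R : rcfType) (m : nat) : R := (Num.sqrt m%:R)^-1.

Lemma inv_sqrt1 (R : rcfType) : inv_sqrt R 1 = 1.
Proof. by rewrite /inv_sqrt sqrtr1 invr1. Qed.

Lemma inv_sqrtM (R : rcfType) (a b : nat) :
  inv_sqrt R (a * b) = inv_sqrt R a * inv_sqrt R b.
Proof. by rewrite /inv_sqrt natrM sqrtrM // invfM. Qed.

Lemma inv_sqrtX (R : rcfType) (a e : nat) : inv_sqrt R (a ^ e) = inv_sqrt R a ^+ e.
Proof.
by elim: e => [|e IH]; [rewrite inv_sqrt1 | rewrite expnS inv_sqrtM IH exprS].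
Qed.

Lemma inv_sqrt_ge0 (R : rcfType) (a : nat) : 0 <= inv_sqrt R a.
Proof. by rewrite invr_ge0 sqrtr_ge0. Qed.

Lemma inv_sqrt_sqr (R : rcfType) (a : nat) : inv_sqrt R a ^+ 2 = a%:R^-1.
Proof. by rewrite /inv_sqrt exprVn sqr_sqrtr. Qed.

(** The product can run over all [q] up to [N] because [logn q m = 0] when [q] is not prime. *)
Lemma inv_sqrt_factorization (R : rcfType) (m N : nat) : (0 < m <= N)%N ->
  inv_sqrt R m = \prod_(q < N.+1) inv_sqrt R q ^+ logn q m.
Proof.
case/andP=> m0 mN; rewrite -{1}(partnT m0) (widen_partn _ mN) big_mkord.
rewrite (big_morph _ (@inv_sqrtM R) (inv_sqrt1 R)).
by apply: eq_bigr => q _; rewrite inv_sqrtX.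
Qed.

(* Rankin's trick: each of the 2k variables z <= N gets the weight (N / z)^(1/2) >= 1,
   and the sum of the z^(-1/2) is then dominated by an Euler product. *)
Lemma card_max_twice_le (R : rcfType) (k N : nat) :
  #|[set z : {ffun 'I_(k + k) -> 'I_N} |
     [forall q : 'I_N.+1, prime q ==> max_twice (fun i => logn q (z i).+1)]]|%:R <=
  N%:R ^+ k * \prod_(q < N.+1 | prime q) local_factor (k + k) N.+1 (inv_sqrt R q).
Proof.
set Z := [set z | _]; pose n := (k + k)%N.
pose E : finType := {ffun 'I_n -> 'I_N.+1}.
(* A vector is encoded by its table of valuations at all [q <= N]; unique factorization makes this
   injective. *)
pose ex (z : {ffun 'I_n -> 'I_N}) : {ffun 'I_N.+1 -> E} :=
  [ffun q => [ffun i => inord (logn (val q) (z i).+1)]].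
have exE z q i : ex z q i = logn q (z i).+1 :> nat.
  rewrite !ffunE inordK // ltnS.
  by rewrite (leq_trans _ (ltn_ord (z i))) // ltnW // ltn_logl.
have ex_inj : injective ex.
  move=> z z' e; apply/ffunP => i; apply/val_inj/succn_inj/eqn_from_log => // q.
  have [qN|Nq] := ltnP q N.+1.
    by have := exE z (Ordinal qN) i; rewrite e exE => ->.
  by rewrite !ltn_log0 ?(leq_ltn_trans (ltn_ord _) Nq).
(* A non-prime [q] only admits the zero row, of weight 1, so the Euler product becomes a product
   over all [q] and can be distributed. *)
pose Q (q : 'I_N.+1) (e : E) :=
  if prime q then max_twice (fun i => e i) else e == [ffun=> ord0].
pose w (q : 'I_N.+1) (e : E) : R := \prod_i inv_sqrt R q ^+ e i.
have w0 q e : 0 <= w q e by apply: prodr_ge0 => i _; rewrite exprn_ge0 ?inv_sqrt_ge0.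
have -> : \prod_(q < N.+1 | prime q) local_factor n N.+1 (inv_sqrt R q) =
    \prod_q \sum_(e | Q q e) w q e.
  rewrite big_mkcond; apply: eq_bigr => q _; rewrite /Q; case: (prime q) => //.
  by rewrite big_pred1_eq /w big1 // => i _; rewrite ffunE.
rewrite bigA_distr_big_dep.
apply: (@le_trans _ _ (N%:R ^+ k * \sum_(z in Z) \prod_q w q (ex z q))).
  rewrite -sum1_card natr_sum mulr_sumr; apply: ler_sum => z _.
  have -> : \prod_q w q (ex z q) = \prod_i inv_sqrt R (z i).+1.
    rewrite exchange_big; apply: eq_bigr => i _ /=.
    rewrite (@inv_sqrt_factorization R _ N) ?ltn_ord //.
    by apply: eq_bigr => q _; rewrite exE.
  have -> : N%:R ^+ k = \prod_(i < n) Num.sqrt N%:R :> R.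
    by rewrite prodr_const card_ord /n addnn -mul2n exprM sqr_sqrtr.
  rewrite -big_split /=; apply: (@le_trans _ _ (\prod_(i < n) (1 : R))).
    by rewrite big1_eq.
  apply: ler_prod => i _; rewrite ler01 /= /inv_sqrt ler_pdivlMr ?sqrtr_gt0 ?ltr0n //.
  by rewrite mul1r ler_wsqrtr // ler_nat.
rewrite ler_wpM2l ?exprn_ge0 //.
(* Tables of vectors in [Z] are among the admissible ones; all other tables have nonnegative
   weight. *)
rewrite -(big_imset (fun f : {ffun 'I_N.+1 -> E} => \prod_q w q (f q)) (in2W ex_inj)).
rewrite [leRHS](bigID (mem (ex @: Z))) /= -[leLHS]addr0; apply: lerD; last first.
  by apply: sumr_ge0 => f _; apply: prodr_ge0.
rewrite le_eqVlt; apply/orP; left; apply/eqP; apply: eq_bigl => f.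
apply/idP/andP => [|[//]] fZ; split=> //; case/imsetP: fZ => z + ->.
rewrite inE => /forallP zZ; apply/familyP => q; rewrite unfold_in /Q.
have := zZ q; case: (boolP (prime q)) => [_ /=|nq _].
  move/forallP => mt; apply/forallP => i; have /existsP[j] := mt i.
  by rewrite -!exE => h; apply/existsP; exists j.
apply/eqP/ffunP => i; apply: val_inj; rewrite /= exE ffunE /=.
by rewrite lognE (negbTE nq).
Qed.

Lemma sum_exists_le (R : numDomainType) (T K : finType) (w : T -> R)
    (P : pred T) (Q : K -> pred T) :
  (forall e, 0 <= w e) -> (forall e, P e -> exists k, Q k e) ->
  \sum_(e | P e) w e <= \sum_k \sum_(e | Q k e) w e.
Proof.
move=> w0 PQ; rewrite (exchange_big_dep xpredT) //= big_mkcond.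
apply: ler_sum => e _; have nn : 0 <= \sum_(k | Q k e) w e by rewrite sumr_ge0.
case: ifP => // /PQ[k Qk].
by rewrite (bigD1 k) //= lerDl sumr_ge0.
Qed.

Lemma geometric_sum_le (R : realFieldType) (s : R) (L : nat) :
  0 <= s < 1 -> \sum_(e < L) s ^+ e <= (1 - s)^-1.
Proof.
case/andP=> s0 s1; rewrite -[leRHS]mul1r ler_pdivlMr ?subr_gt0 // mulrC.
have -> : (1 - s) * \sum_(e < L) s ^+ e = 1 - s ^+ L.
  by have := subrX1 s L; lra.
by rewrite gerBl exprn_ge0.
Qed.

Lemma card_ltn_pairs (n : nat) :
  #|[pred ij : 'I_n * 'I_n | (ij.1 < ij.2)%N]| = 'C(n, 2).
Proof.
rewrite -sum1_card -(pair_big_dep xpredT (fun i j : 'I_n => (i < j)%N) (fun _ _ => 1%N)) /=.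
rewrite (exchange_big_dep xpredT) //= -bin2_sum big_mkord; apply: eq_bigr => j _.
by rewrite (big_ord_narrow (ltnW (ltn_ord j))) sum1_card card_ord.
Qed.

(** The zero vector contributes 1. Any other admissible vector has two indices [i < j] with a common
    maximal value [a > 0]; for fixed [(i, j, a)] these give [s ^+ (2 * a)], and each remaining
    coordinate at most a geometric series. Summing over [a] gives [s ^+ 2 / (1 - s ^+ 2)]. *)
Lemma local_factor_le (R : realFieldType) (n L : nat) (s : R) : 0 <= s < 1 ->
  local_factor n L.+1 s <=
  1 + 'C(n, 2)%:R * (s ^+ 2 / (1 - s ^+ 2)) * (1 - s)^-1 ^+ (n - 2).
Proof.
move=> s01; have /andP[s0 s1] := s01.
pose E : finType := {ffun 'I_n -> 'I_L.+1}.
pose w (e : E) := \prod_i s ^+ e i.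
have w0 e : 0 <= w e by apply: prodr_ge0 => i _; rewrite exprn_ge0.
pose e0 : E := [ffun=> ord0].
have we0 : w e0 = 1 by rewrite /w big1 // => i _; rewrite ffunE.
have ltn_neq0 (e : E) : e != e0 -> exists i, (0 < e i)%N.
  move=> ne; apply/existsP; apply: contraR ne => /existsPn e_0.
  apply/eqP/ffunP => i; apply: val_inj; rewrite ffunE /=.
  by apply/eqP; rewrite -leqn0 leqNgt e_0.
rewrite /local_factor (bigID (pred1 e0)) /=; apply: lerD.
  apply: (@le_trans _ _ (\sum_(e | e == e0) w e)); last by rewrite big_pred1_eq we0.
  rewrite big_mkcond [leRHS]big_mkcond /=; apply: ler_sum => e _.
  by case: (e == e0); rewrite ?andbF ?andbT //; case: ifP => // _; apply: w0.
pose K : finType := (('I_n * 'I_n) * 'I_L.+1)%type.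
pose Q (k : K) (e : E) :=
  [&& (k.1.1 < k.1.2)%N, (0 < k.2)%N, e k.1.1 == k.2 & e k.1.2 == k.2].
apply: (@le_trans _ _ (\sum_k \sum_(e | Q k e) w e)).
  apply: sum_exists_le => // e /andP[/forallP mt /ltn_neq0[i1 ei1]].
  have [i _ imax'] := @arg_maxnP _ i1 xpredT (fun i => e i) isT.
  have imax j : (e j <= e i)%N := imax' j isT.
  have /existsP[j /andP[ji eij]] := mt i.
  have eji : e j = e i by apply/val_inj/eqP; rewrite eqn_leq eij imax.
  have ei : (0 < e i)%N by rewrite (leq_trans _ (imax i1)).
  have [ltij|ltji|/val_inj eq_ij] := ltngtP i j; last by rewrite eq_ij eqxx in ji.
    by exists ((i, j), e i); rewrite /Q /= ltij ei eji eqxx.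
  by exists ((j, i), e i); rewrite /Q /= ltji ei eji eqxx.
pose G := (1 - s)^-1.
have G0 : 0 <= G by rewrite invr_ge0 subr_ge0 ltW.
have main (i j : 'I_n) (a : 'I_L.+1) : (i < j)%N ->
    \sum_(e : E | (e i == a) && (e j == a)) w e <= s ^+ (2 * a) * G ^+ (n - 2).
  move=> ij; have nij : j != i by rewrite -val_eqE /= gtn_eqF.
  (* Fixing two coordinates is a condition on each coordinate separately, so the sum factors. *)
  pose Qij l := [pred b : 'I_L.+1 | ((l == i) || (l == j)) ==> (b == a)].
  have -> : \sum_(e : E | (e i == a) && (e j == a)) w e =
      \prod_l \sum_(b | Qij l b) s ^+ b.
    rewrite bigA_distr_big_dep; apply: eq_bigl => e.
    apply/andP/familyP => [[ei ej] l|h]; rewrite ?inE.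
      by apply/implyP => /orP[] /eqP ->.
    by split; [have := h i | have := h j]; rewrite !inE eqxx ?orbT.
  have one l : (l == i) || (l == j) -> \sum_(b | Qij l b) s ^+ b = s ^+ a.
    move=> h; rewrite -[RHS](big_pred1_eq +%R a (fun b : 'I_L.+1 => s ^+ b)).
    by apply: eq_bigl => b; rewrite /= h.
  rewrite (bigD1 i) //= (bigD1 j) //= !one ?eqxx ?orbT // mulrA -exprD addnn -mul2n.
  rewrite ler_wpM2l ?exprn_ge0 //.
  apply: (@le_trans _ _ (\prod_(l | (l != i) && (l != j)) G)).
    apply: ler_prod => l /andP[/negbTE li /negbTE lj].
    rewrite sumr_ge0 => [|b _]; last by rewrite exprn_ge0.
    under eq_bigl do rewrite /= li lj.
    exact: geometric_sum_le.
  rewrite prodr_const.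
  have -> : #|[pred l : 'I_n | (l != i) && (l != j)]| = (n - 2)%N.
    rewrite (@eq_card _ _ (predC (mem [set i; j]))) => [|l]; last first.
      by rewrite !inE negb_or.
    have := cardC (mem [set i; j]); rewrite cards2 (eq_sym i j) nij card_ord.
    by set c := #|predC _| => h; move: h; clearbody c => h; lia.
  by [].
have bound (k : K) : \sum_(e | Q k e) w e <=
    (k.1.1 < k.1.2)%N%:R * ((0 < k.2)%N%:R * s ^+ (2 * k.2) * G ^+ (n - 2)).
  case: k => [[i j] a]; rewrite /Q /=.
  case: (ltnP i j) => ij /=; last by rewrite big_pred0 // mul0r.
  case: (ltnP 0 a) => a0 /=; last by rewrite big_pred0 // !mul0r mulr0.
  by rewrite !mul1r main.
apply: le_trans (ler_sum _ (fun k _ => bound k)) _.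
rewrite -(pair_big xpredT xpredT (fun (ij : 'I_n * 'I_n) (a : 'I_L.+1) =>
   (ij.1 < ij.2)%N%:R * ((0 < a)%N%:R * s ^+ (2 * a) * G ^+ (n - 2)))) /=.
under eq_bigr do rewrite -mulr_sumr -mulr_suml.
rewrite -mulr_suml mulrA ler_wpM2r ?exprn_ge0 //.
have -> : \sum_(ij : 'I_n * 'I_n) (ij.1 < ij.2)%N%:R = 'C(n, 2)%:R :> R.
  rewrite -card_ltn_pairs -sum1_card natr_sum big_mkcond [RHS]big_mkcond /=.
  by apply: eq_bigr => ij _; rewrite inE; case: ltnP.
rewrite ler_wpM2l // big_ord_recl /= mul0r add0r.
apply: (@le_trans _ _ (s ^+ 2 * \sum_(a < L) (s ^+ 2) ^+ a)).
  rewrite mulr_sumr; apply: ler_sum => a _.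
  by rewrite mul1r /= -exprS exprM.
by rewrite ler_wpM2l ?exprn_ge0 // geometric_sum_le // exprn_ge0 //= exprn_ilt1.
Qed.

(** * Prime sums *)

Lemma prod_primes_dvdn (s : seq nat) (n : nat) :
  uniq s -> (forall q, q \in s -> prime q && (q %| n)%N) ->
  (\prod_(q <- s) q %| n)%N.
Proof.
elim: s => [|q s IH] /=; first by rewrite big_nil dvd1n.
case/andP=> qs us sP; rewrite big_cons.
have [pq qn] := andP (sP q (mem_head _ _)).
rewrite Gauss_dvd ?qn ?IH // => [r rs|]; first by rewrite sP // inE rs orbT.
rewrite prime_coprime // big_seq_cond Euclid_dvd_prod // big1 // => r.
rewrite andbT => rs; have /andP[pr _] : prime r && (r %| n)%N by rewrite sP // inE rs orbT.
by rewrite dvdn_prime2 //; apply: contraNF qs => /eqP ->.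
Qed.

Lemma prime_dvdn_fact (q n : nat) : prime q -> (q %| n`!)%N = (q <= n)%N.
Proof.
move=> pq; have [qn|nq] := leqP q n; first by rewrite dvdn_fact // prime_gt0.
rewrite fact_prod Euclid_dvd_prod // big_nat_cond big1 // => i.
by rewrite andbT ltnS => /andP[i0 i_n]; rewrite gtnNdvd // (leq_ltn_trans i_n).
Qed.

(** A prime in (m, 2m] divides (2m)! but not m!. *)
Lemma prod_primes_dvdn_bin (m : nat) :
  (\prod_(m.+1 <= q < (2 * m).+1 | prime q) q %| 'C(2 * m, m))%N.
Proof.
rewrite -big_filter; apply: prod_primes_dvdn => [|q].
  by rewrite filter_uniq // iota_uniq.
rewrite mem_filter mem_index_iota => /and3P[pq mq qm]; rewrite pq /=.
have : (q %| (2 * m)`!)%N by rewrite prime_dvdn_fact.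
have le : (m <= 2 * m)%N by rewrite leq_pmull.
rewrite -(bin_fact le) mul2n -addnn addnK !Euclid_dvdM // prime_dvdn_fact //.
by rewrite (leqNgt q m) mq !orbF.
Qed.

Lemma bin_le_pow2 (n m : nat) : ('C(n, m) <= 2 ^ n)%N.
Proof.
have [mn|nm] := leqP m n; last by rewrite bin_small.
rewrite -[2%N]/(1 + 1)%N expnDn (bigD1 (Ordinal (leq_ltn_trans mn (ltnSn n)))) //=.
by rewrite !exp1n !muln1 leq_addr.
Qed.

(** The primes of the block all exceed 2^j, and their product divides a binomial coefficient that is
    at most 2^(2^(j+1)). *)
Lemma chebyshev_dyadic (j : nat) :
  (j * \sum_((2 ^ j).+1 <= q < (2 ^ j.+1).+1 | prime q) 1 <= 2 ^ j.+1)%N.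
Proof.
rewrite -(@leq_exp2l 2) // expnM expn_sum [X in (_ <= 2 ^ X)%N]expnS [in leqLHS]expnS.
apply: leq_trans (bin_le_pow2 _ (2 ^ j)).
apply: leq_trans (dvdn_leq _ (prod_primes_dvdn_bin _)); last first.
  by rewrite bin_gt0 leq_pmull.
rewrite big_nat_cond [leqRHS]big_nat_cond; apply: leq_prod => q.
by rewrite expn1 => /andP[/andP[/ltnW]].
Qed.

(** The prime 2 gives 1, and each further dyadic block gives 2/j by Chebyshev. The terms are 1/(q-1)
    because this is [s ^+ 2 / (1 - s ^+ 2)] at [s] = q^(-1/2). *)
Lemma sum_prime_inv_dyadic (F : realFieldType) (J : nat) :
  \sum_(0 <= q < (2 ^ J.+1).+1 | prime q) q.-1%:R^-1 <=
  1 + 2 * \sum_(j < J) j.+1%:R^-1 :> F.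
Proof.
elim: J => [|J IH].
  rewrite big_ord0 mulr0 addr0 big_mkcond expn1 !big_nat_recr // big_geq //=.
  by rewrite !add0r invr1.
rewrite (@big_cat_nat _ _ _ (2 ^ J.+1).+1) //=; last first.
  by rewrite ltnS leq_exp2l.
rewrite big_ord_recr /= mulrDr addrA; apply: lerD => //.
apply: (@le_trans _ _ (\sum_((2 ^ J.+1).+1 <= q < (2 ^ J.+2).+1 | prime q) ((2 ^ J.+1)%:R^-1 : F))).
  rewrite big_nat_cond [leRHS]big_nat_cond; apply: ler_sum => q /andP[/andP[q1 _] pq].
  have p2 : (0 < 2 ^ J.+1)%N by rewrite expn_gt0.
  have qp : (2 ^ J.+1 <= q.-1)%N by rewrite -ltnS prednK ?prime_gt0.
  by rewrite lef_pV2 ?posrE ?ltr0n ?ler_nat // (leq_trans p2).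
have -> : \sum_((2 ^ J.+1).+1 <= q < (2 ^ J.+2).+1 | prime q) ((2 ^ J.+1)%:R^-1 : F) =
   (\sum_((2 ^ J.+1).+1 <= q < (2 ^ J.+2).+1 | prime q) 1)%N%:R / (2 ^ J.+1)%:R.
  by rewrite natr_sum mulr_suml; apply: eq_bigr => q _; rewrite mul1r.
rewrite ler_pdivrMr ?ltr0n ?expn_gt0 // mulrAC ler_pdivlMr ?ltr0n //.
by rewrite -natrM mulnC -[2]/(2%:R) -natrM ler_nat -expnS; apply: chebyshev_dyadic.
Qed.

Lemma mul2_bin2 (n : nat) : (2 * 'C(n, 2) = n * n.-1)%N.
Proof. by rewrite mulnC -[X in (_ * X)%N]/(2`!) bin_ffact ffactnS ffactn1. Qed.

(** * Bounding the Euler product *)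

(** Telescoping: with consecutive square roots a <= b, one has 1/b <= 2(b - a). *)
Lemma sum_inv_sqrt_le (R : rcfType) (M : nat) :
  \sum_(0 <= q < M.+1) inv_sqrt R q <= 2 * Num.sqrt M%:R.
Proof.
elim: M => [|M IH].
  by rewrite big_nat1 /inv_sqrt sqrtr0 invr0 mulr0.
rewrite big_nat_recr //=; apply: le_trans (lerD IH (lexx _)) _.
rewrite /inv_sqrt; set a := Num.sqrt M%:R; set b := Num.sqrt M.+1%:R.
have b0 : 0 < b by rewrite sqrtr_gt0 ltr0n.
have ab : a <= b by rewrite ler_wsqrtr // ler_nat.
have a2 : a * a = M%:R by rewrite -expr2 sqr_sqrtr.
have b2 : b * b = M%:R + 1 by rewrite -expr2 sqr_sqrtr // natr1.
rewrite -lerBrDl -mulrBr -(ler_pM2r b0) mulVf ?gt_eqF //.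
nra.
Qed.

Lemma sum_inv_sqrt_cube_le (R : rcfType) (m d : nat) : (0 < m)%N ->
  \sum_(m.+1 <= q < (m + d).+1) inv_sqrt R q ^+ 3 <= 2 * inv_sqrt R m.
Proof.
(* The telescoped form carries the induction: with consecutive square roots a <= b, one has 1/b^3 <=
   2(1/a - 1/b). *)
move=> m0; suff : \sum_(m.+1 <= q < (m + d).+1) inv_sqrt R q ^+ 3 <=
    2 * inv_sqrt R m - 2 * inv_sqrt R (m + d).
  by move/le_trans; apply; rewrite lerBlDr lerDl mulr_ge0 // inv_sqrt_ge0.
elim: d => [|d IH]; first by rewrite addn0 big_geq // subrr.
rewrite addnS big_nat_recr /= ?ltnS ?leq_addr //.
apply: le_trans (lerD IH (lexx _)) _.
have M0 : (0 < m + d)%N by rewrite addn_gt0 m0.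
move: (m + d)%N M0 => M M0; rewrite /inv_sqrt.
set a := Num.sqrt M%:R; set b := Num.sqrt M.+1%:R.
have a0 : 0 < a by rewrite sqrtr_gt0 ltr0n.
have b0 : 0 < b by rewrite sqrtr_gt0 ltr0n.
have ab : a <= b by rewrite ler_wsqrtr // ler_nat.
have a2 : a ^+ 2 = M%:R by rewrite sqr_sqrtr.
have b2 : b ^+ 2 = M%:R + 1 by rewrite sqr_sqrtr // natr1.
suff : b^-1 ^+ 3 <= 2 * (a^-1 - b^-1) by lra.
have -> : 2 * (a^-1 - b^-1) = 2 * (b ^+ 2 - a ^+ 2) / (a * b * (a + b)).
  by field; rewrite !gt_eqF // addr_gt0.
rewrite a2 b2 addrC addrA addNr add0r mulr1 exprVn.
rewrite -[leLHS]mul1r ler_pdivrMr ?exprn_gt0 // mulrAC ler_pdivlMr ?mulr_gt0 ?addr_gt0 //.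
nra.
Qed.

Lemma expR1_le3 (R : realType) : expR 1 <= 3 :> R.
Proof.
(* This gives e <= (6/5)^6 < 3. *)
have h : (5 / 6 : R) <= expR (- (1 / 6)) by apply: le_trans (expR_ge1Dx _); lra.
have e6 : expR 1 = (expR (- (1 / 6)))^-1 ^+ 6 :> R.
  by rewrite -expRN opprK -expRM_natr; congr expR; lra.
rewrite e6; apply: (@le_trans _ _ ((5 / 6)^-1 ^+ 6)); last by lra.
by rewrite lerXn2r ?nnegrE ?invr_ge0 ?expR_ge0 // lef_pV2 // posrE ?expR_gt0.
Qed.

Lemma inv_onem_le_expR (R : realType) (s : R) :
  0 <= s -> s ^+ 2 <= 1 / 2 -> (1 - s)^-1 <= expR (2 * s).
Proof.
(* [283 / 400] lies just above 1/sqrt 2, the value of [s] at the prime 2. *)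
move=> s0 s2; have s1 : s < 283 / 400.
  by rewrite ltNge; apply/negP => h; nra.
(* The exponential is minorized by [(1 + u) ^+ 5], which leaves a polynomial inequality on a short
   interval. *)
pose u := 2 / 5 * s.
have -> : expR (2 * s) = expR u ^+ 5 by rewrite -expRM_natl /u; congr expR; lra.
have : (1 + u) ^+ 5 <= expR u ^+ 5.
  by rewrite lerXn2r ?nnegrE ?expR_ge0 ?expR_ge1Dx // /u; lra.
apply: le_trans; rewrite -[leLHS]mul1r ler_pdivrMr ?subr_gt0; last by lra.
have -> : s = 5 / 2 * u by rewrite /u; lra.
have u0 : 0 <= u by rewrite /u; lra.
have u1 : u <= (283 / 1000) by rewrite /u; lra.
have u2 : u ^+ 2 <= (2 / 25) by rewrite /u exprMn; lra.
have u3 : u ^+ 3 <= (2 / 25) * (283 / 1000) by rewrite exprSr ler_pM ?exprn_ge0.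
have u4 : u ^+ 4 <= (2 / 25) * (283 / 1000) * (283 / 1000) by rewrite exprSr ler_pM ?exprn_ge0.
have u5 : u ^+ 5 <= (2 / 25) * (283 / 1000) * (283 / 1000) * (283 / 1000).
  by rewrite exprSr ler_pM ?exprn_ge0.
rewrite -subr_ge0.
have -> : (1 + u) ^+ 5 * (1 - 5 / 2 * u) - 1 =
  u * (5 / 2 - 5 / 2 * u - 15 * u ^+ 2 - 20 * u ^+ 3 - 23 / 2 * u ^+ 4 - 5 / 2 * u ^+ 5).
  by field.
by rewrite mulr_ge0 //; lra.
Qed.

(** The ratio of successive left sides is exp(1/(J+2)) <= (J+2)/(J+1), from 1 - v <= exp(-v); the
    start is e <= 3. *)
Lemma expR_harmonic_le (R : realType) (J : nat) :
  expR (\sum_(j < J.+1) j.+1%:R^-1) <= 3 * J.+1%:R :> R.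
Proof.
elim: J => [|J IH]; first by rewrite big_ord1 invr1 mulr1 expR1_le3.
rewrite big_ord_recr /= expRD; set v := J.+2%:R^-1 : R.
have v0 : 0 < v by rewrite invr_gt0 ltr0n.
have Jv : J.+2%:R * v = 1 :> R by rewrite mulfV // pnatr_eq0.
have ev : expR v * J.+1%:R <= J.+2%:R :> R.
  rewrite -[expR v]invrK -expRN mulrC ler_pdivrMr ?expR_gt0 //.
  apply: (@le_trans _ _ (J.+2%:R * (1 - v))).
    by rewrite mulrBr mulr1 Jv -[J.+2%:R]natr1 addrK.
  by rewrite ler_wpM2l // expR_ge1Dx.
apply: (@le_trans _ _ (3 * J.+1%:R * expR v)); first by rewrite ler_wpM2r ?expR_ge0.
by rewrite -mulrA ler_wpM2l // mulrC.
Qed.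

Lemma expR_harmonic_trunc_log_le (R : realType) (N p : nat) :
  (0 < N < p)%N -> (2 < p)%N ->
  expR (\sum_(j < trunc_log 2 N) j.+1%:R^-1) <= 6 * ln p%:R :> R.
Proof.
case/andP=> N0 Np p2.
have ln_p1 : 1 <= ln p%:R :> R.
  rewrite -[leLHS](@expRK R) ler_ln ?posrE ?expR_gt0 ?ltr0n ?(leq_trans _ p2) //.
  by apply: le_trans (expR1_le3 R) _; rewrite ler_nat.
case: (trunc_log 2 N) (trunc_logP (isT : 1 < 2)%N N0) => [_|J JN].
  by rewrite big_ord0 expR0; lra.
apply: le_trans (expR_harmonic_le R J) _.
(* The number of dyadic blocks is at most log_2 p, and ln 2 >= 1/2. *)
suff : J.+1%:R <= 2 * ln p%:R :> R by lra.
have ln2 : 1 / 2 <= ln 2 :> R.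
  rewrite -[leLHS](@expRK R) ler_ln ?posrE ?expR_gt0 //.
  rewrite -[expR _]invrK -expRN -[leRHS]invrK lef_pV2 ?posrE ?expR_gt0 ?invr_gt0 //.
  by apply: le_trans (expR_ge1Dx _); lra.
have : ln (2 ^+ J.+1) <= ln p%:R :> R.
  rewrite ler_ln ?posrE ?exprn_gt0 ?ltr0n ?(leq_trans _ p2) // -natrX ler_nat.
  exact: leq_trans JN (ltnW Np).
have -> : ln (2 ^+ J.+1) = J.+1%:R * ln 2 :> R by rewrite lnXn // mulr_natl.
have : J.+1%:R * (1 / 2) <= J.+1%:R * ln 2 :> R by rewrite ler_wpM2l.
lra.
Qed.

(* With s = q^(-1/2), the local factor is at most exp('C(n, 2) / (q - 1)) times
   (1 - s)^-(n - 2) <= exp(2 (n - 2) s). This suffices for q <= n^2; for larger q one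
   expands the second exponential first, to get a convergent sum over q. *)
Definition local_excess (R : rcfType) (n q : nat) : R :=
  if (q <= n ^ 2)%N then 2 * inv_sqrt R q
  else 36 * 'C(n, 2)%:R * inv_sqrt R q ^+ 3.

Lemma local_excess_ge0 (R : rcfType) (n q : nat) : 0 <= local_excess R n q.
Proof. by rewrite /local_excess; case: ifP => _; rewrite !mulr_ge0 ?exprn_ge0 ?inv_sqrt_ge0. Qed.

Lemma sum_local_excess_le (R : rcfType) (n N : nat) : (0 < n)%N ->
  \sum_(0 <= q < N.+1) local_excess R n q <= 40 * n%:R.
Proof.
move=> n0; apply: (@le_trans _ _ (\sum_(0 <= q < (n ^ 2 + N).+1) local_excess R n q)).
  rewrite [leRHS](@big_cat_nat _ _ _ N.+1) ?ltnS ?leq_addl //= lerDl.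
  by apply: sumr_ge0 => q _; apply: local_excess_ge0.
rewrite (@big_cat_nat _ _ _ (n ^ 2).+1) ?ltnS ?leq_addr //=.
have sn : Num.sqrt (n ^ 2)%:R = n%:R :> R by rewrite natrX sqrtr_sqr ger0_norm.
have h1 : \sum_(0 <= q < (n ^ 2).+1) local_excess R n q <= 4 * n%:R.
  apply: (@le_trans _ _ (2 * \sum_(0 <= q < (n ^ 2).+1) inv_sqrt R q)).
    rewrite mulr_sumr big_nat_cond [leRHS]big_nat_cond.
    apply: ler_sum => q /andP[/andP[_]]; rewrite ltnS => qn _.
    by rewrite /local_excess qn.
  by have := sum_inv_sqrt_le R (n ^ 2); rewrite sn; lra.
have h2 : \sum_((n ^ 2).+1 <= q < (n ^ 2 + N).+1) local_excess R n q <=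
    36 * 'C(n, 2)%:R * (2 / n%:R).
  apply: (@le_trans _ _ (36 * 'C(n, 2)%:R *
      \sum_((n ^ 2).+1 <= q < (n ^ 2 + N).+1) inv_sqrt R q ^+ 3)).
    rewrite mulr_sumr big_nat_cond [leRHS]big_nat_cond.
    apply: ler_sum => q /andP[/andP[nq _] _].
    by rewrite /local_excess leqNgt nq.
  rewrite ler_wpM2l ?mulr_ge0 //.
  by rewrite -[X in _ / X]sn sum_inv_sqrt_cube_le // expn_gt0 n0.
have bn : 2 * 'C(n, 2)%:R = n%:R * (n%:R - 1) :> R.
  by rewrite -natrM mul2_bin2 natrM -subn1 natrB.
have h3 : 36 * 'C(n, 2)%:R * (2 / n%:R) = 36 * (n%:R - 1) :> R.
  transitivity (36 / n%:R * (2 * 'C(n, 2)%:R) : R); first by ring.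
  by rewrite bn; field; rewrite pnatr_eq0 -lt0n.
by lra.
Qed.

Lemma local_factor_le_expR (R : realType) (n L q : nat) : prime q -> (1 < n)%N ->
  local_factor n L.+1 (inv_sqrt R q) <=
  expR ('C(n, 2)%:R * q.-1%:R^-1 + (n - 2)%:R * local_excess R n q).
Proof.
move=> pq n1; set s := inv_sqrt R q; set b := 'C(n, 2)%:R; set m := (n - 2)%N.
have q1 := prime_gt1 pq; have q0 := prime_gt0 pq.
have q2 : 2 <= q%:R :> R by rewrite ler_nat.
have s0 : 0 <= s := inv_sqrt_ge0 R q.
have s2 : s ^+ 2 = q%:R^-1 := inv_sqrt_sqr R q.
have qs2 : q%:R * s ^+ 2 = 1 :> R by rewrite s2 mulfV // pnatr_eq0 -lt0n.
have s2h : s ^+ 2 <= 1 / 2 by rewrite s2 mul1r lef_pV2 // posrE ltr0n.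
have s1 : s < 1 by rewrite ltNge; apply/negP => h; nra.
pose t : R := b * q.-1%:R^-1.
have t0 : 0 <= t by rewrite mulr_ge0 ?invr_ge0 // ler0n.
have qm1 : q.-1%:R = q%:R - 1 :> R by rewrite -subn1 natrB.
have ts : b * (s ^+ 2 / (1 - s ^+ 2)) = t.
  rewrite /t s2 qm1; congr (_ * _); field.
  by apply/andP; split; rewrite gt_eqF //; lra.
pose y := 2 * m%:R * s.
have y0 : 0 <= y by rewrite !mulr_ge0.
have vy : (1 - s)^-1 ^+ m <= expR y.
  have -> : expR y = expR (2 * s) ^+ m by rewrite -expRM_natl /y; congr expR; ring.
  by rewrite lerXn2r ?nnegrE ?expR_ge0 ?invr_ge0 ?inv_onem_le_expR // subr_ge0 ltW.
have := @local_factor_le R n L s; rewrite s0 s1 => /(_ isT) /le_trans; apply.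
rewrite ts -/m /local_excess -/s -/b.
apply: (@le_trans _ _ (1 + t * expR y)); first by rewrite lerD2l ler_wpM2l.
case: leqP => qn.
  have -> : t + m%:R * (2 * s) = t + y by rewrite /y; ring.
  rewrite expRD; apply: (@le_trans _ _ ((1 + t) * expR y)).
    by rewrite mulrDl mul1r lerD2r; apply: le_trans (expR_ge1Dx _); rewrite lerDl.
  by rewrite ler_wpM2r ?expR_ge0 ?expR_ge1Dx.
have ns : n%:R * s <= 1.
  rewrite -(@ler_pXn2r _ 2) ?nnegrE ?mulr_ge0 // expr1n exprMn s2 -natrX.
  by rewrite ler_pdivrMr ?ltr0n // mul1r ler_nat ltnW.
have y2 : y <= 2.
  have : m%:R * s <= n%:R * s by rewrite ler_wpM2r // ler_nat leq_subr.
  by rewrite /y; lra.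
(* Since [y <= 2], exp y <= 9; combined with (1 - y) exp y <= 1 this yields the linear bound. *)
have ey : expR y <= 1 + 9 * y.
  have e2 : expR y <= 9.
    apply: (@le_trans _ _ (expR 1 ^+ 2)); first by rewrite -expRM_natl mulr1 ler_expR.
    have := expR1_le3 R; have := expR_ge0 (1 : R); nra.
  have : (1 - y) * expR y <= 1.
    have : 1 - y <= expR (- y) by exact: expR_ge1Dx.
    rewrite expRN => h; rewrite -[leRHS](@mulVf _ (expR y)) ?gt_eqF ?expR_gt0 //.
    by rewrite ler_wpM2r ?expR_ge0.
  have : y * expR y <= y * 9 by rewrite ler_wpM2l.
  lra.
apply: (@le_trans _ _ (1 + t * (1 + 9 * y))); first by rewrite lerD2l ler_wpM2l.
apply: le_trans (expR_ge1Dx _); rewrite lerD2l mulrDr mulr1 lerD2l.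
have -> : t * (9 * y) = m%:R * (18 * b * s * q.-1%:R^-1) by rewrite /t /y; ring.
rewrite ler_wpM2l //.
(* As q - 1 >= q/2, the constant 18 doubles to the 36 of [local_excess]. *)
have iq : q.-1%:R^-1 <= 2 * s ^+ 2.
  rewrite -[leLHS]mul1r ler_pdivrMr qm1; last by lra.
  have : s ^+ 2 * 2 <= s ^+ 2 * q%:R by rewrite ler_wpM2l ?exprn_ge0.
  lra.
apply: (@le_trans _ _ (18 * b * s * (2 * s ^+ 2))).
  by rewrite ler_wpM2l // !mulr_ge0 // ler0n.
by rewrite le_eqVlt; apply/orP; left; apply/eqP; ring.
Qed.

(** The exponential bounds for the local factors multiply, and their exponents are summed by the
    dyadic prime estimate and the bound on the total excess. *)
Lemma rational_energy_le (R : realType) (m N p : nat) :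
  (0 < N < p)%N -> (2 < p)%N ->
  (rational_energy m.+1 N)%:R <=
  N%:R ^+ m.+1 * expR (7 * 'C(m.+1 + m.+1, 2)%:R + 160 * (m.+1 * m)%:R) *
  ln p%:R ^+ (2 * 'C(m.+1 + m.+1, 2)) :> R.
Proof.
move=> Np p2; have /andP[N0 _] := Np; set n := (m.+1 + m.+1)%N.
have n1 : (1 < n)%N by rewrite /n addSn addnS.
have := rational_energy_le_max_twice m.+1 N; rewrite -(ler_nat R) => /le_trans; apply.
apply: le_trans (card_max_twice_le R m.+1 N) _; rewrite -mulrA.
rewrite ler_wpM2l ?exprn_ge0 // -/n.
set b := 'C(n, 2); set J := trunc_log 2 N; set H := \sum_(j < J) j.+1%:R^-1 : R.
have primes_le : \sum_(q < N.+1 | prime q) q.-1%:R^-1 <= 1 + 2 * H.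
  apply: le_trans (sum_prime_inv_dyadic R J).
  rewrite -(big_mkord prime (fun q => q.-1%:R^-1)).
  have NJ : (N.+1 <= (2 ^ J.+1).+1)%N by rewrite ltnS ltnW // trunc_log_ltn.
  rewrite [leRHS](@big_cat_nat _ _ _ N.+1) //= lerDl.
  by apply: sumr_ge0 => q _; rewrite invr_ge0.
have excess_le : \sum_(q < N.+1 | prime q) local_excess R n q <= 40 * n%:R.
  apply: le_trans (@sum_local_excess_le R n N (ltnW n1)).
  rewrite big_mkord big_mkcond; apply: ler_sum => q _.
  by case: ifP => // _; apply: local_excess_ge0.
apply: (@le_trans _ _ (expR (b%:R * (1 + 2 * H) + (n - 2)%:R * (40 * n%:R)))).
  apply: (@le_trans _ _ (\prod_(q < N.+1 | prime q)
      expR (b%:R * q.-1%:R^-1 + (n - 2)%:R * local_excess R n q))).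
    apply: ler_prod => q pq; rewrite local_factor_le_expR // andbT.
    by apply: sumr_ge0 => e _; apply: prodr_ge0 => i _; rewrite exprn_ge0 ?inv_sqrt_ge0.
  rewrite -expR_sum ler_expR big_split /= -!mulr_sumr.
  by rewrite lerD // ler_wpM2l.
have -> : b%:R * (1 + 2 * H) + (n - 2)%:R * (40 * n%:R) =
    (b%:R + 160 * (m.+1 * m)%:R) + (2 * b)%:R * H.
  have -> : (n - 2)%:R = 2 * m%:R :> R by rewrite -natrM; congr _%:R; rewrite /n; lia.
  have -> : n%:R = 2 * m.+1%:R :> R by rewrite -natrM; congr _%:R; rewrite /n; lia.
  by rewrite !natrM; ring.
(* The extra 6b = 2b * 3 absorbs the constant in exp H <= 6 ln p, because 6 <= e^3. *)
have -> : 7 * b%:R + 160 * (m.+1 * m)%:R =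
    (b%:R + 160 * (m.+1 * m)%:R) + (2 * b)%:R * 3 :> R.
  by rewrite !natrM; ring.
set c := _ + 160 * _; rewrite !(expRD c) -mulrA ler_wpM2l ?expR_ge0 //.
rewrite !expRM_natl -exprMn lerXn2r ?nnegrE ?expR_ge0 ?mulr_ge0 ?expR_ge0 //.
  by rewrite ln_ge0 // ler1n (leq_trans _ p2).
apply: le_trans (expR_harmonic_trunc_log_le R Np p2) _.
rewrite ler_wpM2r //; first by rewrite ln_ge0 // ler1n (leq_trans _ p2).
have -> : expR 3 = expR 1 ^+ 3 :> R by rewrite -expRM_natl mulr1.
have e2 : 2 <= expR 1 :> R by apply: le_trans (expR_ge1Dx _); lra.
have : (2 : R) ^+ 3 <= expR 1 ^+ 3 by rewrite lerXn2r ?nnegrE ?expR_ge0.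
lra.
Qed.

(** * The exponential sum *)

Local Open Scope complex_scope.

(** With e <= 4 the left side is at most 2k * 4^c. For k >= 2 one has 4 <= 2k, so only exponents are
    compared; k = 1 is checked apart. *)
Lemma explicit_constant_lt (R : realType) (m : nat) :
  (2 * m.+1)%:R * expR (7 * 'C(m.+1 + m.+1, 2)%:R + 160 * (m.+1 * m)%:R) <
  (2 * m.+1)%:R ^+ (90 * m.+1 ^ 3) :> R.
Proof.
set k := m.+1; set c := (7 * 'C(k + k, 2) + 160 * (k * m))%N.
have ck : (c = 7 * (k * (2 * k - 1)) + 160 * (k * m))%N.
  congr (_ * _ + _)%N; apply/eqP; rewrite -(eqn_pmul2l (isT : 0 < 2)%N) mul2_bin2 addnn -mul2n.
  by rewrite -mulnA subn1.
have -> : 7 * 'C(k + k, 2)%:R + 160 * (k * m)%:R = c%:R * 1 :> R.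
  by rewrite /c natrD !natrM mulr1.
rewrite expRM_natl.
apply: (@le_lt_trans _ _ (((2 * k) * 4 ^ c)%N%:R)).
  rewrite [leRHS]natrM ler_wpM2l // natrX lerXn2r ?nnegrE ?expR_ge0 //.
  by apply: le_trans (expR1_le3 R) _; rewrite ler_nat.
rewrite -natrX ltr_nat ck /k; case: m {c ck} @k => [|m].
  by rewrite muln1 -[X in (_ * X ^ _)%N]/(2 ^ 2)%N -expnM -expnS ltn_exp2l.
move=> k; have k2 : (4 <= 2 * m.+2)%N by lia.
apply: (@leq_ltn_trans ((2 * m.+2) ^ (7 * (m.+2 * (2 * m.+2 - 1)) + 160 * (m.+2 * m.+1)).+1)).
  by rewrite expnS leq_mul2l leq_exp2r ?k2 ?orbT //; lia.
rewrite ltn_exp2l; last by lia.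
rewrite expnS expnS expn1; nia.
Qed.

Lemma energy_inverses_lt (R : realType) (m N p : nat) :
  prime p -> (2 < p)%N -> (0 < N < p)%N ->
  Num.sqrt p%:R * (energy (fun i : 'I_N => i.+1%:R^-1 : 'F_p) m.+1)%:R <
  (2 * m.+1)%:R ^+ (90 * m.+1 ^ 3) * ln p%:R ^+ (4 * m.+1 ^ 2) *
  (N%:R ^+ m / Num.sqrt p%:R + Num.sqrt p%:R / N%:R ^+ m.+1) *
  N%:R ^+ (2 * m.+1) :> R.
Proof.
move=> pp p2 Np; have /andP[N0 Np'] := Np.
set E := energy _ _; set r := Num.sqrt p%:R : R; set k := m.+1.
have p0 : 0 < p%:R :> R by rewrite ltr0n prime_gt0.
have r0 : 0 < r by rewrite sqrtr_gt0.
have r2 : r ^+ 2 = p%:R by rewrite sqr_sqrtr.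
have N0' : 0 < N%:R :> R by rewrite ltr0n.
have ln_p1 : 1 <= ln p%:R :> R.
  rewrite -[leLHS](@expRK R) ler_ln ?posrE ?expR_gt0 //.
  by apply: le_trans (expR1_le3 R) _; rewrite ler_nat.
set X := N%:R ^+ m / r + r / N%:R ^+ k.
have X0 : 0 < X by rewrite addr_gt0 ?divr_gt0 ?exprn_gt0.
(* Dividing by sqrt p, the count becomes N^(2k-1)/r + r = X N^k. *)
have hE : r * E%:R <= (2 * k)%:R * X * N%:R ^+ k * (rational_energy k N)%:R.
  have := energy_inverses_le m pp Np'; rewrite -(ler_nat R) -/E.
  rewrite natrM !(natrM, natrD, natrX) -/k -/r -r2 => h.
  have rNN : 0 <= r / r ^+ 2 by rewrite divr_ge0 ?exprn_ge0 // ltW.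
  have := ler_wpM2l rNN h.
  have -> : r / r ^+ 2 * (r ^+ 2 * E%:R) = r * E%:R by field; rewrite gt_eqF.
  move/le_trans; apply; rewrite mulrA ler_wpM2r //.
  have -> : 2 * k%:R * X * N%:R ^+ k =
     2 * k%:R * (N%:R ^+ m * N%:R ^+ k / r) + 2 * k%:R * r.
    by rewrite /X; field; rewrite gt_eqF // expf_neq0 // gt_eqF.
  have -> : r / r ^+ 2 * (2 * (k%:R * N%:R ^+ m) * N%:R ^+ k + 2 * r ^+ 2) =
     2 * k%:R * (N%:R ^+ m * N%:R ^+ k / r) + 2 * r.
    by field; rewrite gt_eqF.
  have k1 : 1 <= k%:R :> R by rewrite ler1n.
  by rewrite lerD2l; apply: ler_wpM2r; [exact: ltW | lra].
apply: le_lt_trans hE _.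
have hR := rational_energy_le R m Np p2; rewrite -/k in hR.
apply: (@le_lt_trans _ _ ((2 * k)%:R * expR (7 * 'C(k + k, 2)%:R + 160 * (k * m)%:R) *
   (ln p%:R ^+ (4 * k ^ 2) * X * N%:R ^+ (2 * k)))).
  have W : 0 <= (2 * k)%:R * X * N%:R ^+ k.
    by rewrite !mulr_ge0 ?exprn_ge0 // ltW.
  apply: le_trans (ler_wpM2l W hR) _.
  set e := expR _; set l := ln _.
  have -> : (2 * k)%:R * X * N%:R ^+ k * (N%:R ^+ k * e * l ^+ (2 * 'C(k + k, 2))) =
    (2 * k)%:R * e * (l ^+ (2 * 'C(k + k, 2)) * X * N%:R ^+ (2 * k)).
    by rewrite [(2 * k)%N]mul2n -addnn [N%:R ^+ (k + k)]exprD; ring.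
  rewrite ler_wpM2l ?mulr_ge0 ?expR_ge0 // ler_wpM2r ?exprn_ge0 //.
  apply: ler_wpM2r; first exact: ltW.
  (* The exponent 2k(2k - 1) is raised to 4k^2, using ln p >= 1. *)
  by rewrite ler_weXn2l // mul2_bin2 addnn -mul2n -subn1 expnS expn1; nia.
rewrite -!mulrA mulrA ltr_pM2r ?explicit_constant_lt //.
by rewrite !mulr_gt0 ?exprn_gt0 // (lt_le_trans ltr01).
Qed.

(** * Additive characters of the prime field *)

Section Character.
Variable R : realType.

Lemma epD (p : nat) (x y : int) : ep R p (x + y) = ep R p x * ep R p y.
Proof.
rewrite /ep rmorphD /= mulrDr mulrDl cosD sinD.
by congr (Complex _ _); rewrite addrC [cos _ * sin _]mulrC.
Qed.

Lemma norm_ep (p : nat) (x : int) : `|ep R p x| = 1.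
Proof. by rewrite normc_def /= cos2Dsin2 sqrtr1. Qed.

Lemma ep0 (p : nat) : ep R p 0 = 1.
Proof. by rewrite /ep mulr0 mul0r cos0 sin0. Qed.

Lemma ep_period (p : nat) (x : int) : (0 < p)%N -> ep R p (x * p%:Z) = 1.
Proof.
move=> p0; have ep_p : ep R p p%:Z = 1.
  rewrite /ep -pmulrn mulfK ?pnatr_eq0 -?lt0n // mulr_natl.
  by rewrite cos2pi sin2pi.
have nat_case n : ep R p (n%:Z * p%:Z) = 1.
  elim: n => [|n IH]; first by rewrite mul0r ep0.
  by rewrite intS mulrDl mul1r epD ep_p IH mulr1.
case: (intP x) => [|n|n]; [exact: (nat_case 0%N) | exact: nat_case |].
have := epD p (n.+1%:Z * p%:Z) (- n.+1%:Z * p%:Z).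
by rewrite mulNr subrr ep0 nat_case mul1r.
Qed.

Lemma ep_modz (p : nat) (x : int) : (0 < p)%N -> ep R p (x %% p)%Z = ep R p x.
Proof.
by move=> p0; rewrite [in RHS](divz_eq x p) [RHS]epD ep_period ?mul1r.
Qed.

Lemma ep_neq1 (p : nat) (a : int) : (1 < p)%N -> coprimez a p -> ep R p a != 1.
Proof.
move=> p1 ap; have p0 := ltnW p1; rewrite -ep_modz //.
have r0 : 0 < (a %% p)%Z.
  rewrite lt_def modz_ge0 ?andbT; last by rewrite eqz_nat -lt0n.
  apply: contraL ap => /eqP/dvdz_mod0P pa.
  rewrite /coprimez gcdzC /gcdz; move: pa; rewrite dvdzE /= => /gcdn_idPl ->.
  by rewrite eqz_nat gtn_eqF.
have rp : (a %% p)%Z < p%:Z by apply: ltz_pmod; rewrite ltz_nat.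
move: (a %% p)%Z r0 rp => r r0 rp; apply/eqP => /(congr1 (@complex.Re R)) /=.
(* Half the angle lies strictly between 0 and pi, so sin t > 0 and cos(2t) = 1 - 2 sin^2 t < 1. *)
pose t : R := pi * r%:~R / p%:R.
have -> : 2 * pi * r%:~R / p%:R = t + t by rewrite /t; field; rewrite pnatr_eq0 -lt0n.
have : 0 < sin t.
  have p0' : 0 < p%:R :> R by rewrite ltr0n.
  apply: sin_gt0_pi; rewrite divr_gt0 ?mulr_gt0 ?pi_gt0 ?ltr0z //=.
  by rewrite ltr_pdivrMr // ltr_pM2l ?pi_gt0 // pmulrn ltr_int.
have := cos2Dsin2 t; rewrite cosD => h1 h2; nra.
Qed.

Definition twisted_character (p : nat) (a : int) (x : 'F_p) : R[i] :=
  ep R p (a * (nat_of_ord x)%:Z).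

Lemma twisted_character_modn (p : nat) (a : int) (n : nat) : (0 < p)%N ->
  ep R p (a * (n %% p)%N%:Z) = ep R p (a * n%:Z).
Proof.
move=> p0; rewrite {2}(divn_eq n p) PoszD PoszM mulrDr epD mulrA ep_period //.
by rewrite mul1r.
Qed.

Lemma twisted_characterD (p : nat) (a : int) : prime p ->
  {morph twisted_character a : x y / x + y : 'F_p >-> x * y}.
Proof.
move=> pp x y; have p0 := prime_gt0 pp.
rewrite /twisted_character.
have -> : nat_of_ord (x + y) = ((x + y)%N %% p)%N by rewrite -[X in (_ %% X)%N](Fp_cast pp).
by rewrite twisted_character_modn // PoszD mulrDr epD.
Qed.

Lemma twisted_characterM (p : nat) (a : int) (x y : 'F_p) : prime p ->
  twisted_character a (x * y) = ep R p (a * (nat_of_ord x)%:Z * (nat_of_ord y)%:Z).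
Proof.
move=> pp; have p0 := prime_gt0 pp; rewrite /twisted_character.
have -> : nat_of_ord (x * y) = ((x * y)%N %% p)%N by rewrite -[X in (_ %% X)%N](Fp_cast pp).
by rewrite twisted_character_modn // PoszM mulrA.
Qed.

(** Shifting [x] by [c^-1] multiplies the sum by the character value at 1, which is not 1. *)
Lemma sum_twisted_character (p : nat) (a : int) (c : 'F_p) :
  prime p -> coprimez a p -> c != 0 ->
  \sum_x twisted_character a (c * x) = 0.
Proof.
move=> pp ap c0; set S := \sum_x _.
have psi1 : twisted_character a (1 : 'F_p) != 1.
  rewrite /twisted_character.
  have -> : nat_of_ord (1 : 'F_p) = 1%N by [].
  by rewrite mulr1 ep_neq1 ?prime_gt1.
have : twisted_character a (1 : 'F_p) * S = S.
  rewrite {2}/S (reindex_inj (addrI c^-1)) /= mulr_sumr; apply: eq_bigr => x _.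
  by rewrite mulrDr mulfV // twisted_characterD.
move/eqP; rewrite -subr_eq0 -{2}[S]mul1r -mulrBl mulf_eq0 subr_eq0 (negbTE psi1).
by move/eqP.
Qed.

End Character.

Lemma powR_exprn (R : realType) (a x : R) (n t : nat) :
  0 <= a -> x * n%:R = t%:R -> (a `^ x) ^+ n = a ^+ t.
Proof. by move=> a0 xnt; rewrite -powR_mulrn ?powR_ge0 // -powRrM xnt powR_mulrn. Qed.

(** The bilinear bound for the functions x -> x^* on both intervals. The modulus is complex-valued
    in [R[i]], so [w] carries it as a real number. *)
Lemma kloosterman_sum_bound (R : realType) (p N1 N2 m1 m2 : nat) (a : int)
    (alpha1 alpha2 : nat -> R[i]) (w : R) :
  prime p -> coprimez a p%:Z -> (N1 < p)%N -> (N2 < p)%N ->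
  (forall x1 : nat, (1 <= x1 <= N1)%N -> `|alpha1 x1| <= 1) ->
  (forall x2 : nat, (1 <= x2 <= N2)%N -> `|alpha2 x2| <= 1) ->
  `| \sum_(1 <= x1 < N1.+1) \sum_(1 <= x2 < N2.+1)
       alpha1 x1 * alpha2 x2
         * ep R p (a * (modinv p x1)%:Z * (modinv p x2)%:Z) | = w%:C ->
  w ^+ (2 * (m1.+1 * m2.+1)) <=
  (N2 ^ (m1 * m2.+1) * N1 ^ (m1.+1 * m2))%:R ^+ 2 *
  (p * energy (fun i : 'I_N1 => i.+1%:R^-1 : 'F_p) m1.+1 *
       energy (fun i : 'I_N2 => i.+1%:R^-1 : 'F_p) m2.+1)%:R.
Proof.
move=> pp ap N1p N2p a1 a2 we.
have := @bilinear_sum_bound _ _ (@twisted_character R p a) (@twisted_characterD R p a pp)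
  (fun x => norm_ep _ _ _) (fun c => @sum_twisted_character R p a c pp ap)
  _ _ (fun i : 'I_N1 => i.+1%:R^-1) (fun i : 'I_N2 => i.+1%:R^-1)
  (fun i => alpha1 i.+1) (fun i => alpha2 i.+1) m1 m2
  (fun i => a1 i.+1 (ltn_ord i)) (fun i => a2 i.+1 (ltn_ord i)).
rewrite !card_ord Fp_cast //.
under eq_bigr => i _ do under eq_bigr => j _ do rewrite twisted_characterM //.
move: we; rewrite big_add1 big_mkord /=.
under eq_bigr => i _ do rewrite big_add1 big_mkord /=.
move=> ->; rewrite -lecR !rmorphM !rmorphXn /= !rmorph_nat.
by [].
Qed.

Theorem theorem8 (R : realType) :
  exists p0 : nat,
  forall (p : nat), prime p -> (p0 <= p)%N ->
  forall (N1 N2 : nat), (0 < N1 < p)%N -> (0 < N2 < p)%N ->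
  forall (alpha1 alpha2 : nat -> R[i]),
    (forall x1 : nat, (1 <= x1 <= N1)%N -> `|alpha1 x1| <= 1) ->
    (forall x2 : nat, (1 <= x2 <= N2)%N -> `|alpha2 x2| <= 1) ->
  forall (k1 k2 : nat), (0 < k1)%N -> (0 < k2)%N ->
  forall (a : int), coprimez a p%:Z ->
  `| \sum_(1 <= x1 < N1.+1) \sum_(1 <= x2 < N2.+1)
       alpha1 x1 * alpha2 x2
         * ep R p (a * (modinv p x1)%:Z * (modinv p x2)%:Z) |
  < ( (2 * k1%:R) `^ (45 * k1%:R ^+ 2 / k2%:R)
      * (2 * k2%:R) `^ (45 * k2%:R ^+ 2 / k1%:R)
      * (ln p%:R) `^ (2 * (k1%:R / k2%:R + k2%:R / k1%:R))
      * (N1%:R ^+ (k1 - 1) / Num.sqrt p%:R + Num.sqrt p%:R / N1%:R ^+ k1)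
          `^ (1 / (2 * k1%:R * k2%:R))
      * (N2%:R ^+ (k2 - 1) / Num.sqrt p%:R + Num.sqrt p%:R / N2%:R ^+ k2)
          `^ (1 / (2 * k1%:R * k2%:R))
      * N1%:R * N2%:R : R)%:C.
Proof.
(* From [3 <= p] and e <= 3 follows ln p >= 1. *)
exists 3%N => p pp p3 N1 N2 hN1 hN2 alpha1 alpha2 a1 a2 [//|m1] [//|m2] _ _ a ap.
have /andP[N1_gt0 N1p] := hN1; have /andP[N2_gt0 N2p] := hN2.
set W := `|_|; pose w := complex.Re W.
have we : W = w%:C by rewrite /w /W normc_def.
have w0 : 0 <= w by rewrite /w /W normc_def sqrtr_ge0.
have key := kloosterman_sum_bound m1 m2 pp ap N1p N2p a1 a2 we.
rewrite we ltcR !subn1 /=; clearbody w; clear we W.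
set r := Num.sqrt p%:R.
set X1 := _ + r / N1%:R ^+ _; set X2 := _ + r / N2%:R ^+ _.
set l := ln _; set k1 := m1.+1 in key X1 *; set k2 := m2.+1 in key X2 *.
have k1n : k1%:R != 0 :> R by rewrite pnatr_eq0.
have k2n : k2%:R != 0 :> R by rewrite pnatr_eq0.
have N1' : 0 < N1%:R :> R by rewrite ltr0n.
have N2' : 0 < N2%:R :> R by rewrite ltr0n.
have p0 : 0 < p%:R :> R by rewrite ltr0n prime_gt0.
have r0 : 0 < r by rewrite sqrtr_gt0.
have r2 : r ^+ 2 = p%:R by rewrite sqr_sqrtr.
have X1_gt0 : 0 < X1 by rewrite addr_gt0 ?divr_gt0 ?exprn_gt0.
have X2_gt0 : 0 < X2 by rewrite addr_gt0 ?divr_gt0 ?exprn_gt0.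
have l0 : 0 <= l by rewrite ln_ge0 // ler1n prime_gt0.
have E1 := energy_inverses_lt R m1 pp p3 hN1.
have E2 := energy_inverses_lt R m2 pp p3 hN2.
rewrite -/r -/l -/k1 -/X1 in E1; rewrite -/r -/l -/k2 -/X2 in E2.
set n := (2 * (k1 * k2))%N; have n0 : (0 < n)%N by [].
(* The power n = 2 k1 k2 clears all real exponents: 45 k1^2/k2 becomes 90 k1^3, that of ln p becomes
   4 k1^2 + 4 k2^2, and those of [X1] and [X2] become 1. *)
rewrite -(@ltr_pXn2r _ n) // ?nnegrE //; last by rewrite !mulr_ge0 ?powR_ge0.
have nE : n%:R = 2 * k1%:R * k2%:R :> R by rewrite /n !natrM mulrA.
rewrite !exprMn.
rewrite (@powR_exprn _ (2 * k1%:R) _ n (90 * k1 ^ 3)) ?mulr_ge0 //; last first.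
  by rewrite nE natrM natrX; field.
rewrite (@powR_exprn _ (2 * k2%:R) _ n (90 * k2 ^ 3)) ?mulr_ge0 //; last first.
  by rewrite nE natrM natrX; field.
rewrite (@powR_exprn _ l _ n (4 * k1 ^ 2 + 4 * k2 ^ 2)) //; last first.
  by rewrite nE natrD !natrM; field; rewrite k1n k2n.
rewrite (@powR_exprn _ X1 _ n 1) ?ltW //; last by rewrite nE; field; rewrite k1n k2n.
rewrite (@powR_exprn _ X2 _ n 1) ?ltW //; last by rewrite nE; field; rewrite k1n k2n.
apply: le_lt_trans key _.
move: E1 E2; set e1 := energy _ _; set e2 := energy _ _ => E1 E2.
(* Of p = r^2, one factor [r] goes to each energy, as in [E1] and [E2]. *)
have -> : (N2 ^ (m1 * k2) * N1 ^ (k1 * m2))%:R ^+ 2 * (p * e1 * e2)%:R =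
  (N2%:R ^+ (2 * (m1 * k2)) * N1%:R ^+ (2 * (k1 * m2))) * ((r * e1%:R) * (r * e2%:R)).
  rewrite !natrM !natrX -r2 exprMn -!exprM ![(_ * 2)%N]mulnC; ring.
have -> : (2 * k1%:R) ^+ (90 * k1 ^ 3) * (2 * k2%:R) ^+ (90 * k2 ^ 3) *
   l ^+ (4 * k1 ^ 2 + 4 * k2 ^ 2) * X1 ^+ 1 * X2 ^+ 1 * N1%:R ^+ n * N2%:R ^+ n =
   (N2%:R ^+ (2 * (m1 * k2)) * N1%:R ^+ (2 * (k1 * m2))) *
   (((2 * k1)%:R ^+ (90 * k1 ^ 3) * l ^+ (4 * k1 ^ 2) * X1 * N1%:R ^+ (2 * k1)) *
    ((2 * k2)%:R ^+ (90 * k2 ^ 3) * l ^+ (4 * k2 ^ 2) * X2 * N2%:R ^+ (2 * k2))).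
  (* The first power matches the loss in Hoelder's inequality, the second the energy bound. *)
  have -> : N1%:R ^+ n = N1%:R ^+ (2 * (k1 * m2)) * N1%:R ^+ (2 * k1) :> R.
    by rewrite -exprD; congr (_ ^+ _); rewrite /n /k2 mulnS mulnDr addnC.
  have -> : N2%:R ^+ n = N2%:R ^+ (2 * (m1 * k2)) * N2%:R ^+ (2 * k2) :> R.
    by rewrite -exprD; congr (_ ^+ _); rewrite -mulnDr addnC -mulSn.
  rewrite !natrM exprD !expr1; ring.
rewrite ltr_pM2l; last by rewrite mulr_gt0 ?exprn_gt0.
by apply: ltr_pM => //; rewrite mulr_ge0 // ltW.
Qed.
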